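(* Let $K$ be a field and let $I$ be a complete intersection of $3$ quadrics in the polynomial ring $K[x_1,\dots,x_n]$, i.e. $I=(g_1,g_2,g_3)$ with $g_1,g_2,g_3$ a regular sequence of homogeneous polynomials of degree $2$. Let $K[I_3]$ be the $K$-subalgebra of $K[x_1,\dots,x_n]$ generated by the vector space $I_3$ of all forms of degree $3$ in $I$. Then $K[I_3]$ is Koszul.
   Context: $K[x_1,\dots,x_n]$ has the standard grading. $K[I_3]=K[x_ig_j : 1\le i\le n,\ 1\le j\le 3]$ is regarded as a standard graded $K$-algebra with the elements of $I_3$ placed in degree $1$. A standard graded $K$-algebra $A$ (that is, $A=\bigoplus_{i\ge0}A_i$ commutative, $A_0=K$, $\dim_KA_1<\infty$, generated by $A_1$) is Koszul if the residue field $K=A/A_+$ has a linear $A$-free resolution, i.e. $\operatorname{Tor}_i^A(K,K)_j=0$ for all $j\neq i$. *)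

(* Defs.v *)
From HB Require Import structures.
From mathcomp Require Import all_boot all_order all_algebra.
From mathcomp Require Import boolp mpoly.

Set Implicit Arguments.
Unset Strict Implicit.
Unset Printing Implicit Defensive.

Import GRing.Theory.
Local Open Scope ring_scope.

Section Ideals.
Variable R : comNzRingType.

Definition ideal_gen (s : seq R) (f : R) : Prop :=
  exists c : 'I_(size s) -> R, f = \sum_(i < size s) c i * s`_i.

Definition regular_sequence (s : seq R) : Prop :=
  (forall (i : nat) (f : R), (i < size s)%N ->
     ideal_gen (take i s) (s`_i * f) -> ideal_gen (take i s) f)
  /\ ~ ideal_gen s 1.

End Ideals.

Section GeneratedSubalgebra.
Variables (K : fieldType) (B : comAlgType K).

Definition subalg_gen (S : {pred B}) : {pred B} :=
  [pred x | `[< forall T : {pred B},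
      GRing.subalg_closed T -> {subset S <= T} -> x \in T >]].

Lemma subalg_gen_closed (S : {pred B}) : GRing.subalg_closed (subalg_gen S).
Proof.
split=> [|a x y /asboolP Sx /asboolP Sy|x y /asboolP Sx /asboolP Sy];
  apply/asboolP => T Talg ST; have [T1 Tlin TM] := Talg => //.
- exact: Tlin (Sx T Talg ST) (Sy T Talg ST).
- exact: TM (Sx T Talg ST) (Sy T Talg ST).
Qed.

HB.instance Definition _ (S : {pred B}) :=
  GRing.isSubalgClosed.Build K B (subalg_gen S)
    (GRing.subalg_closed_semi (subalg_gen_closed S)).

Record generated_algebra (S : {pred B}) := GeneratedAlgebra {
  generated_val :> B;
  _ : generated_val \in subalg_gen S
}.

HB.instance Definition _ (S : {pred B}) :=
  [isSub for @generated_val S].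
HB.instance Definition _ (S : {pred B}) :=
  [Choice of generated_algebra S by <:].
HB.instance Definition _ (S : {pred B}) :=
  [SubChoice_isSubAlgebra of generated_algebra S by <:].
HB.instance Definition _ (S : {pred B}) :=
  GRing.SubPzRing_isSubComPzRing.Build B (subalg_gen S) (generated_algebra S).

End GeneratedSubalgebra.

Section GradedAlgebras.
Variables (K : fieldType) (A : comAlgType K).

(* [gr i] is the set of homogeneous elements of degree i (0 included). *)
Variable gr : nat -> {pred A}.

Definition graded_algebra : Prop :=
  [/\ forall i, GRing.submod_closed (gr i),
      1 \in gr 0%N,
      forall i j a b, a \in gr i -> b \in gr j -> a * b \in gr (i + j)%N,
      forall a, exists m (f : nat -> A),
        (forall i, f i \in gr i) /\ a = \sum_(i < m) f i
    & forall m (f : nat -> A), (forall i, f i \in gr i) ->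
        \sum_(i < m) f i = 0 -> forall i, (i < m)%N -> f i = 0].

Definition standard_graded : Prop :=
  [/\ graded_algebra,
      forall a, a \in gr 0%N <-> exists c : K, a = c%:A,
      exists s : seq A, {subset s <= gr 1%N} /\
        forall a, a \in gr 1%N ->
          exists c : 'I_(size s) -> K, a = \sum_(i < size s) c i *: s`_i
    & forall a, a \in subalg_gen (gr 1%N)].

(* Membership in A_+, the sum of the components of positive degree. *)
Definition irrelevant_ideal (a : A) : Prop :=
  exists m (f : nat -> A),
    (forall i, f i \in gr i.+1) /\ a = \sum_(i < m) f i.

(* [a] is homogeneous of degree p - q, where elements of negative degree
   vanish. *)
Definition homog_diff (p q : nat) (a : A) : Prop :=
  if (q <= p)%N then (a \in gr (p - q)%N : Prop) else a = 0.

(* A resolution ... -> F_1 -> F_0 -> K = A / A_+ -> 0 by graded free modules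
   of finite rank and maps of degree 0. F_i consists of row vectors of length
   [res_rank i], its c-th basis vector has degree [res_deg i c], and maps act
   by right multiplication. [res_aug] lists the images in K of the basis of
   F_0; since K is identified with A / A_+, a vector v of F_0 is mapped to 0
   when the lift \sum_c v_c (res_aug c)%:A lies in A_+. *)
Record graded_free_resolution := GradedFreeResolution {
  res_rank : nat -> nat;
  res_deg : forall i, 'I_(res_rank i) -> nat;
  res_aug : 'cV[K]_(res_rank 0);
  res_diff : forall i, 'M[A]_(res_rank i.+1, res_rank i);
  res_aug_homog : forall c, res_deg c != 0%N -> res_aug c 0 = 0;
  res_diff_homog : forall i r c,
    homog_diff (res_deg r) (res_deg c) (res_diff i r c);
  res_aug_surj : res_aug != 0;
  res_exact0 : forall v : 'rV[A]_(res_rank 0),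
    irrelevant_ideal (\sum_c v 0 c * (res_aug c 0)%:A)
    <-> exists w : 'rV[A]_(res_rank 1), v = w *m res_diff 0;
  res_exactS : forall i (v : 'rV[A]_(res_rank i.+1)),
    v *m res_diff i = 0
    <-> exists w : 'rV[A]_(res_rank i.+2), v = w *m res_diff i.+1
}.

Definition linear_resolution (F : graded_free_resolution) : Prop :=
  forall i (c : 'I_(res_rank F i)), res_deg c = i.

Definition koszul : Prop :=
  standard_graded /\ exists F : graded_free_resolution, linear_resolution F.

End GradedAlgebras.

Section FormsInIdeal.
Variables (K : fieldType) (n : nat).

(* I_d, for the ideal I generated by s. *)
Definition ideal_forms (s : seq {mpoly K[n]}) (d : nat) : {pred {mpoly K[n]}} :=
  [pred f | `[< ideal_gen s f >] && (f \is d.-homog)].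

(* K[I_d] *)
Definition ideal_forms_algebra (s : seq {mpoly K[n]}) (d : nat) :
    comAlgType K :=
  generated_algebra (ideal_forms s d).

(* The grading of K[I_d] in which the elements of I_d have degree 1. *)
Definition ideal_forms_grading (s : seq {mpoly K[n]}) (d : nat) :
    nat -> {pred ideal_forms_algebra s d} :=
  fun i => [pred a | generated_val a \is (d * i).-homog].

End FormsInIdeal.

(* Main.v *)
(* Let S = K[x; y_1, y_2, y_3], bigraded, and let y_j be sent to g_j. Since the
   g_j form a regular sequence, the kernel is J3 = (m12, m13, m23), where m_ij is
   the minor g_i y_j - g_j y_i of bidegree (2, 1), and K[I_3] is the diagonal
   subalgebra of S/J3, with pieces of bidegree (i, i). One climbs
   0 < J1 = (m12) < J2 = (m12, m13) < J3, starting from the Segre product, the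
   diagonal of S, over which the quotients of S by variables and their twists
   have linear resolutions. A minor m adjoined to an ideal J becomes the quadrics
   m y_j of the diagonal. If the ideal which they generate modulo J has a linear
   resolution, then every module which has a linear resolution over the diagonal
   of S/J and is killed by m has one over the diagonal of S/(J, m). For J2 and
   m23 this ideal is the twist of S/(J2 : m23) by y_2, y_3, where
   J2 : m23 = (g_1, y_1). As J2 : y_1 = J3 moreover, the modules of (g_1, y_1)
   and of J3 over the diagonal of S/J2 are alternately syzygies of each other,
   whence the linearity of both by induction. *)

Require Import Defs.
From HB Require Import structures.
From mathcomp Require Import all_boot all_order all_algebra ring.
From mathcomp Require Import boolp mpoly.

Set Implicit Arguments.
Unset Strict Implicit.
Unset Printing Implicit Defensive.

Import GRing.Theory.
Local Open Scope ring_scope.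

(** The minors have bidegree (2, 1), off the diagonal, so the steps cannot be carried out inside the
    diagonal algebras alone. Everything stays in S instead: a module is an ideal of S together with
    generators of one common bidegree, and multiplication by an off-diagonal h identifies a twist of
    S/(N : h) with the kernel of S/N -> S/(h, N). This is where the twists by the x's and by the y's
    come from. Passing from J to (J, m) works because the quadrics m y_j have linear relations among
    themselves: the first step of a resolution over J also serves over (J, m), and its syzygies only
    acquire further linear generators. Ideals need to agree only in bidegrees (i, i). There g_1
    contributes no more than the products g_1 y_j, so (g_1, y_1) may replace (y_1) + J2, and a zero
    divisor y_2 can act as a regular element. Linearity is counted over a finite number p of steps,
    so that modules which are syzygies of each other can be treated by induction on p. An infinite
    resolution is assembled only at the end. *)

Section LinearModules.
Variables (S : comNzRingType) (D : nat -> S -> Prop).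
Hypotheses (D0 : forall i, D i 0) (D1 : D 0 1)
  (DB : forall i a b, D i a -> D i b -> D i (a - b))
  (DM : forall i j a b, D i a -> D j b -> D (i + j) (a * b)).

(** * Linear resolutions over the quotient of a graded ring *)

Definition is_ideal (J : S -> Prop) :=
  J 0 /\ forall c a b, J a -> J b -> J (c * a + b).

Definition entries (P : S -> Prop) m n (M : 'M[S]_(m, n)) :=
  forall i j, P (M i j).

Definition is_submod r (U : 'rV[S]_r -> Prop) :=
  U 0 /\ forall c u v, U u -> U v -> U (c *: u + v).

(* [U] is the module of relations, with coefficients in the quotient by [J] of
   the graded algebra with pieces [D i], between [r] generators of degree 0 of a
   module whose resolution is linear for the first [p] steps. Submodules are
   taken in the whole of S^r, but only their elements in the [D i] matter. *)
Fixpoint lin (J : S -> Prop) p r (U : 'rV[S]_r -> Prop) : Prop :=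
  if p is p'.+1 then
    (forall v, entries (D 0) v -> U v -> v = 0) /\
    exists s (W : 'M[S]_(s, r)),
      [/\ entries (D 1) W, forall k, U (row k W),
          forall i v, entries (D i.+1) v -> U v ->
            exists2 c, entries (D i) c & entries J (v - c *m W)
        & lin J p' (fun c : 'rV_s => entries J (c *m W))]
  else True.

Lemma DD i a b : D i a -> D i b -> D i (a + b).
Proof. by move=> Da Db; rewrite -[b]opprK -[- b]sub0r; apply/DB/DB. Qed.

Lemma entriesDM i j m n q (A : 'M[S]_(m, n)) (B : 'M[S]_(n, q)) :
  entries (D i) A -> entries (D j) B -> entries (D (i + j)) (A *m B).
Proof.
move=> hA hB a b; rewrite mxE; elim/big_ind: _ => //; first exact: DD.
by move=> k _; apply: DM.
Qed.

Lemma entriesDB i m n (A B : 'M[S]_(m, n)) :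
  entries (D i) A -> entries (D i) B -> entries (D i) (A - B).
Proof. by move=> hA hB a b; rewrite !mxE; apply: DB. Qed.

Lemma entriesDN i m n (A : 'M[S]_(m, n)) :
  entries (D i) A -> entries (D i) (- A).
Proof.
by move=> hA; rewrite -sub0r; apply: entriesDB => // a b; rewrite mxE.
Qed.

Lemma entriesD0 i m n : entries (D i) (0 : 'M[S]_(m, n)).
Proof. by move=> a b; rewrite mxE. Qed.

Lemma entries_row_mx (P : S -> Prop) m n1 n2
    (A : 'M[S]_(m, n1)) (B : 'M[S]_(m, n2)) :
  entries P (row_mx A B) <-> entries P A /\ entries P B.
Proof.
split=> [h|[hA hB] i j]; last first.
  by rewrite mxE; case: (split j) => k; [apply: hA | apply: hB].
split=> i j; first by have := h i (lshift _ j); rewrite row_mxEl.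
by have := h i (rshift _ j); rewrite row_mxEr.
Qed.

Lemma entries_col_mx (P : S -> Prop) m1 m2 n
    (A : 'M[S]_(m1, n)) (B : 'M[S]_(m2, n)) :
  entries P (col_mx A B) <-> entries P A /\ entries P B.
Proof.
split=> [h|[hA hB] i j]; last first.
  by rewrite mxE; case: (split i) => k; [apply: hA | apply: hB].
split=> i j; first by have := h (lshift _ i) j; rewrite col_mxEu.
by have := h (rshift _ i) j; rewrite col_mxEd.
Qed.

Section Ideal.
Variables (J : S -> Prop) (idJ : is_ideal J).

Lemma ideal0 : J 0. Proof. by case: idJ. Qed.

Lemma idealM c a : J a -> J (c * a).
Proof. by case: idJ => J0 JD Ja; rewrite -[c * a]addr0; apply: JD. Qed.

Lemma idealD a b : J a -> J b -> J (a + b).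
Proof. by case: idJ => _ JD Ja Jb; rewrite -[a]mul1r; apply: JD. Qed.

Lemma idealN a : J a -> J (- a).
Proof. by rewrite -mulN1r; apply: idealM. Qed.

Lemma idealB a b : J a -> J b -> J (a - b).
Proof. by move=> Ja /idealN; apply: idealD. Qed.

Lemma idealBl a b : J (a - b) -> J b -> J a.
Proof. by move=> Jab Jb; rewrite -[a](subrK b); apply: idealD. Qed.

Lemma idealBr a b : J (a - b) -> J a -> J b.
Proof. by move=> Jab Ja; rewrite -[b](subKr a); apply: idealB. Qed.

Lemma entries_ideal0 m n : entries J (0 : 'M[S]_(m, n)).
Proof. by move=> i j; rewrite mxE; apply: ideal0. Qed.

Lemma entries_idealD m n (A B : 'M[S]_(m, n)) :
  entries J A -> entries J B -> entries J (A + B).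
Proof. by move=> hA hB a b; rewrite mxE; apply: idealD. Qed.

Lemma entries_idealB m n (A B : 'M[S]_(m, n)) :
  entries J A -> entries J B -> entries J (A - B).
Proof. by move=> hA hB a b; rewrite !mxE; apply: idealB. Qed.

Lemma entries_idealZ m n c (A : 'M[S]_(m, n)) :
  entries J A -> entries J (c *: A).
Proof. by move=> hA a b; rewrite mxE; apply: idealM. Qed.

Lemma entries_idealMl m n q (A : 'M[S]_(m, n)) (B : 'M[S]_(n, q)) :
  entries J B -> entries J (A *m B).
Proof.
move=> hB a b; rewrite mxE; elim/big_ind: _ => [||k _].
- exact: ideal0.
- exact: idealD.
- exact: idealM.
Qed.

Lemma entries_idealMr m n q (A : 'M[S]_(m, n)) (B : 'M[S]_(n, q)) :
  entries J A -> entries J (A *m B).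
Proof.
by move=> hA; rewrite -[_ *m _]trmxK trmx_mul => a b; rewrite mxE;
  apply: entries_idealMl => i j; rewrite mxE.
Qed.

Lemma submod_ker r s (W : 'M[S]_(s, r)) :
  is_submod (fun c : 'rV_s => entries J (c *m W)).
Proof.
split=> [|c u v hu hv]; first by rewrite mul0mx; apply: entries_ideal0.
by rewrite mulmxDl -scalemxAl; apply: entries_idealD => //;
  apply: entries_idealZ.
Qed.

Lemma ker_ideal r s (W : 'M[S]_(s, r)) (v : 'rV_s) :
  entries J v -> entries J (v *m W).
Proof. exact: entries_idealMr. Qed.

Lemma submodD r (U : 'rV[S]_r -> Prop) u v :
  is_submod U -> U u -> U v -> U (u + v).
Proof. by case=> _ h hu hv; rewrite -[u]scale1r; apply: h. Qed.

Lemma submodZ r (U : 'rV[S]_r -> Prop) c u : is_submod U -> U u -> U (c *: u).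
Proof. by case=> U0 h hu; rewrite -[_ *: _]addr0; apply: h. Qed.

Lemma submodB r (U : 'rV[S]_r -> Prop) u v :
  is_submod U -> U u -> U v -> U (u - v).
Proof.
by move=> sU hu hv; rewrite -[v]scale1r -scaleNr;
  apply/(submodD sU)/(submodZ _ sU).
Qed.

Lemma submod_mulmx r s (U : 'rV[S]_r -> Prop) (W : 'M[S]_(s, r)) c :
  is_submod U -> (forall k, U (row k W)) -> U (c *m W).
Proof.
move=> sU hW; rewrite mulmx_sum_row; elim/big_ind: _ => [||k _].
- by case: sU.
- by move=> u v; apply: submodD.
- exact: submodZ.
Qed.

Lemma lin_ext p r (U V : 'rV[S]_r -> Prop) :
  (forall i v, entries (D i) v -> U v <-> V v) ->
  lin J p U -> lin J p V.
Proof.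
case: p => //= p UV [U0 [s [W [W1 WU genW linW]]]]; split.
  by move=> v v0 /(UV _ _ v0); apply: U0.
exists s, W; split=> // [k|i v vi /(UV _ _ vi)]; last exact: genW.
by apply/(UV 1%N); [move=> a b; rewrite mxE | apply: WU].
Qed.

(** An empty set of generators ([s] is 0) is enough for the relations, and every later syzygy module
    sits in rank 0. *)
Lemma lin_free p r (U : 'rV[S]_r -> Prop) :
  (forall v, entries (D 0) v -> U v -> v = 0) ->
  (forall i v, entries (D i.+1) v -> U v -> entries J v) -> lin J p U.
Proof.
elim: p r U => //= p IH r U U0 UJ; split=> //.
exists 0%N, 0; split=> [|[]//|i v vi Uv|].
- exact: entriesD0.
- by exists 0; [apply: entriesD0 | rewrite mul0mx subr0; apply: UJ Uv].
- by apply: IH => [v|i v]; rewrite [v]thinmx0 // => _ _; apply: entries_ideal0.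
Qed.

(* Horseshoe lemma: [C] is the module of relations of an extension whose
   submodule and quotient have the relations [C0] and [C1]. *)
Lemma lin_extension p r0 r1 (C : 'rV[S]_(r0 + r1) -> Prop)
    (C0 : 'rV[S]_r0 -> Prop) (C1 : 'rV[S]_r1 -> Prop) :
  is_submod C -> (forall v, entries J v -> C v) ->
  (forall i v, entries (D i) v -> C (row_mx v 0) <-> C0 v) ->
  (forall i v, entries (D i) v -> C1 v ->
     exists2 u, entries (D i) u & C (row_mx u v)) ->
  (forall i u v, entries (D i) u -> entries (D i) v ->
     C (row_mx u v) -> C1 v) ->
  lin J p C0 -> lin J p C1 -> lin J p C.
Proof.
elim: p r0 r1 C C0 C1 => //= p IH r0 r1 C C0 C1 sC JC C0E C1lift C1P.
case=> C00 [s0 [W0 [W01 W0C genW0 linW0]]].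
case=> C10 [s1 [W1 [W11 W1C genW1 linW1]]]; split.
  move=> v; rewrite -[v]hsubmxK => /entries_row_mx [v0 v1] Cv.
  have v1E: rsubmx v = 0 by apply: C10 => //; apply: C1P Cv.
  rewrite v1E in Cv *; rewrite [lsubmx v]C00 ?row_mx0 //.
  exact/(C0E _ _ v0).
(* The extension need not split: [L] records the submodule coordinates of the lifted generators, and
   [W] is only block triangular. *)
have liftW1 k : exists2 u, entries (D 1) u & C (row_mx u (row k W1)).
  by apply: C1lift (W1C k) => a b; rewrite mxE.
have [L0 L01 LW] := fin_all_exists2 liftW1.
pose L := \matrix_(k, j) L0 k 0 j.
have rowL k : row k L = L0 k by apply/rowP=> j; rewrite !mxE.
have L1 : entries (D 1) L by move=> a b; rewrite mxE; apply: L01.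
pose W := block_mx W0 0 L W1.
have WC k : C (row k W).
  rewrite -[k]splitK; case: split => j /=.
    rewrite rowKu row_row_mx row0; apply/(C0E 1%N) => // a b.
    by rewrite mxE.
  by rewrite rowKd row_row_mx rowL.
have WE (c0 : 'rV_s0) (c1 : 'rV_s1) :
    row_mx c0 c1 *m W = row_mx (c0 *m W0 + c1 *m L) (c1 *m W1).
  by rewrite mul_row_block mulmx0 add0r.
exists (s0 + s1)%N, W; split=> //.
- apply/entries_col_mx; split; apply/entries_row_mx; split=> //.
  exact: entriesD0.
- move=> i v; rewrite -[v]hsubmxK => /entries_row_mx [v0 v1] Cv.
  have [c1 c1i c1J] := genW1 _ _ v1 (C1P _ _ _ v0 v1 Cv).
  have [||c0 c0i c0J] := genW0 i (lsubmx v - c1 *m L).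
  + by apply: entriesDB => //; rewrite -addn1; apply: entriesDM.
  + apply/(C0E i.+1).
      by apply: entriesDB => //; rewrite -addn1; apply: entriesDM.
    have -> : row_mx (lsubmx v - c1 *m L) 0
        = row_mx (lsubmx v) (rsubmx v) - row_mx 0 c1 *m W
          - row_mx 0 (rsubmx v - c1 *m W1).
      rewrite WE mul0mx add0r !opp_row_mx !add_row_mx oppr0 addr0.
      by rewrite subrr.
    apply: submodB => //; last first.
      apply: JC; apply/entries_row_mx; split=> //; apply: entries_ideal0.
    by apply: submodB => //; apply: submod_mulmx.
  exists (row_mx c0 c1); first by apply/entries_row_mx.
  rewrite WE opp_row_mx add_row_mx; apply/entries_row_mx; split=> //.
  by rewrite opprD addrA addrAC.
(* The syzygies of [W] extend those of [W1] by those of [W0]. If [v *m W1] vanishes modulo J, then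
   [v *m L] is a relation in [C0], hence a combination of rows of [W0]; its negated coefficients
   complete [v] to a syzygy of [W]. *)
- apply: IH linW0 linW1.
  + exact: submod_ker.
  + exact: ker_ideal.
  + move=> i v vi; rewrite WE !mul0mx addr0; split=> [/entries_row_mx[]//|h].
    by apply/entries_row_mx; split=> //; apply: entries_ideal0.
  + move=> i v vi hv; have [||c0 c0i c0J] := genW0 i (v *m L).
    * by rewrite -addn1; apply: entriesDM.
    * apply/(C0E i.+1); first by rewrite -addn1; apply: entriesDM.
      have -> : row_mx (v *m L) 0 = row_mx 0 v *m W - row_mx 0 (v *m W1).
        by rewrite WE mul0mx add0r opp_row_mx add_row_mx oppr0 addr0 subrr.
      apply: (submodB sC); first exact: submod_mulmx.
      apply: JC; apply/entries_row_mx; split=> //; apply: entries_ideal0.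
    exists (- c0); first exact: entriesDN.
    rewrite WE; apply/entries_row_mx; split=> //.
    by rewrite mulNmx addrC.
  + by move=> i u v _ _; rewrite WE => /entries_row_mx[].
Qed.

(* [U] presents [N], [V] presents a submodule of [N] generated by the rows of
   [X], in degree 1, and [U2] presents the quotient. *)
Lemma lin_quotient p r s (U U2 : 'rV[S]_r -> Prop) (X : 'M[S]_(s, r)) :
  is_submod U -> is_submod U2 -> (forall v, entries J v -> U v) ->
  entries (D 1) X -> (forall v, U v -> U2 v) -> (forall k, U2 (row k X)) ->
  (forall v, entries (D 0) v -> U2 v -> U v) ->
  (forall i v, entries (D i.+1) v -> U2 v ->
     exists2 c, entries (D i) c & U (v - c *m X)) ->
  lin J p.+1 U -> lin J p (fun c => U (c *m X)) -> lin J p.+1 U2.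
Proof.
move=> sU sU2 JU X1 UU2 XU2 U20 genX [U0 [s0 [W [W1 WU genW linW]]]] linV.
split=> [v v0 /(U20 _ v0)|]; first exact: U0.
exists (s0 + s)%N, (col_mx W X); split.
- by apply/entries_col_mx.
- move=> k; rewrite -[k]splitK; case: split => j /=.
    by rewrite rowKu; apply: UU2.
  by rewrite rowKd.
- move=> i v vi U2v; have [c ci Uc] := genX _ _ vi U2v.
  have vcX : entries (D i.+1) (v - c *m X).
    by apply: entriesDB => //; rewrite -addn1; apply: entriesDM.
  have [c0 c0i c0J] := genW _ _ vcX Uc.
  exists (row_mx c0 c); first by apply/entries_row_mx.
  by rewrite mul_row_col opprD addrA addrAC.
(* Mapping cone: the generators of [U2] are those of [U] followed by the rows of [X], and U2/U is
   the submodule presented by [V], so the syzygies form an extension. *)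
- apply: lin_extension linW linV.
  + exact: submod_ker.
  + exact: ker_ideal.
  + by move=> i v _; rewrite mul_row_col mul0mx addr0.
  + move=> i v vi Uv.
    have vX : entries (D i.+1) (v *m X) by rewrite -addn1; apply: entriesDM.
    have [c0 c0i c0J] := genW _ _ vX Uv.
    exists (- c0); first exact: entriesDN.
    by rewrite mul_row_col mulNmx addrC.
  + move=> i u v _ _; rewrite mul_row_col => h.
    rewrite -[v *m X](addKr (u *m W)) addrC.
    by apply: submodB => //; [apply: JU | apply: submod_mulmx].
Qed.

Lemma row_gens r s s' (U : 'rV[S]_r -> Prop)
    (W : 'M[S]_(s, r)) (W' : 'M[S]_(s', r)) :
  (forall v, entries (D 1) v -> U v ->
    exists2 c, entries (D 0) c & entries J (v - c *m W)) ->
  entries (D 1) W' -> (forall k, U (row k W')) ->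
  exists2 G, entries (D 0) G & entries J (W' - G *m W).
Proof.
move=> genW W'1 W'U.
have rowG k : exists2 c, entries (D 0) c & entries J (row k W' - c *m W).
  by apply: genW => // a b; rewrite mxE.
have [G0 G00 G0J] := fin_all_exists2 rowG.
exists (\matrix_k G0 k); first by move=> a b; rewrite mxE; apply: G00.
move=> a b; have := G0J a 0 b; congr (J _); rewrite !mxE; congr (_ - _).
by apply: eq_bigr => l _; rewrite mxE.
Qed.

(* The matrix of generators provided by [lin J p U] may depend on [p]; it is
   unique up to invertible matrices, hence one can be chosen for all [p]. *)
Lemma lin_stable r (U : 'rV[S]_r -> Prop) :
  (forall p, lin J p U) ->
  (forall v, entries (D 0) v -> U v -> v = 0) /\
  exists s (W : 'M[S]_(s, r)),
    [/\ entries (D 1) W, forall k, U (row k W),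
        forall i v, entries (D i.+1) v -> U v ->
          exists2 c, entries (D i) c & entries J (v - c *m W)
      & forall p, lin J p (fun c : 'rV_s => entries J (c *m W))].
Proof.
(* Two steps are taken in order to get, besides the generators [W], their minimality [W0]. *)
move=> linU; have [U0 [s [W [W1 WU genW [W0 _]]]]] := linU 2.
split=> //; exists s, W; split=> // -[|p] //.
have [_ [s' [W' [W'1 W'U genW' [W'0 [t [X [X1 XW' genX linX]]]]]]]] :=
  linU p.+2.
have [G G0 GJ] := row_gens (genW 0) W'1 W'U.
have [H H0 HJ] := row_gens (genW' 0) W1 WU.
(* A degree 0 matrix that fixes minimal generators modulo J is the identity, because the rows of 1 -
   A are syzygies of degree 0. Hence [G] and [H] are inverse to each other over S itself, not merely
   modulo J. *)
have inv m (W2 : 'M_(m, r)) (A : 'M_m) : entries (D 0) A ->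
    entries J (W2 - A *m W2) ->
    (forall v : 'rV_m, entries (D 0) v -> entries J (v *m W2) -> v = 0) ->
      A = 1%:M.
  move=> A0 AJ W20; apply/eqP; rewrite eq_sym -subr_eq0;
    apply/eqP/row_matrixP=> k.
  rewrite row0; apply: W20 => [a b|].
    rewrite mxE; apply: (entriesDB (A := 1%:M) _ A0) => c d.
    by rewrite mxE; case: eqP => // _; apply: D0.
  by rewrite -row_mul => a b; rewrite mxE mulmxBl mul1mx; apply: AJ.
have GH : G *m H = 1%:M.
  apply: (inv _ W') => //; first by rewrite -[0%N]addn0; apply: entriesDM.
  have -> : W' - G *m H *m W' = (W' - G *m W) + G *m (W - H *m W').
    by rewrite mulmxBr mulmxA addrA subrK.
  by apply: entries_idealD => //; apply: entries_idealMl.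
have HG : H *m G = 1%:M.
  apply: (inv _ W) => //; first by rewrite -[0%N]addn0; apply: entriesDM.
  have -> : W - H *m G *m W = (W - H *m W') + H *m (W' - G *m W).
    by rewrite mulmxBr mulmxA addrA subrK.
  by apply: entries_idealD => //; apply: entries_idealMl.
split=> //; exists t, (X *m G); split.
- by rewrite -[1%N]addn0; apply: entriesDM.
- move=> k; rewrite row_mul.
  have -> : row k X *m G *m W = row k X *m W' - row k X *m (W' - G *m W).
    by rewrite mulmxBr opprB addrC subrK mulmxA.
  by apply: entries_idealB => //; apply: entries_idealMl.
- move=> i c ci cW; have [||d di dJ] := genX i (c *m H).
  + by rewrite -[i.+1]addn0; apply: entriesDM.
  + have -> : c *m H *m W' = c *m W - c *m (W - H *m W').
      by rewrite mulmxBr opprB addrC subrK mulmxA.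
    by apply: entries_idealB => //; apply: entries_idealMl.
  exists d => //.
  have -> : c - d *m (X *m G) = (c *m H - d *m X) *m G.
    by rewrite mulmxBl -mulmxA HG mulmx1 mulmxA.
  exact: entries_idealMr.
- apply: lin_ext linX => i d _; rewrite mulmxA; split=> [|h].
    exact: entries_idealMr.
  by rewrite -[d *m X]mulmx1 -GH mulmxA; apply: entries_idealMr.
Qed.

End Ideal.

Section ChangeOfRings.
Variables (J J2 : S -> Prop) (idJ : is_ideal J) (idJ2 : is_ideal J2).
Variables (q : nat) (w : 'cV[S]_q).
Hypotheses (JJ2 : forall f, J f -> J2 f)
  (wD : entries (D 2) w) (wJ2 : entries J2 w)
  (genJ2 : forall i f, D i.+2 f -> J2 f ->
     exists2 c : 'rV_q, entries (D i) c & J (f - (c *m w) 0 0))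
  (J2_deg1 : forall f, D 1 f -> J2 f -> J f)
  (linw : forall p, lin J p (fun c : 'rV_q => J ((c *m w) 0 0))).

(* [D/J2] has a presentation by quadrics [w] over [D/J] with linear relations;
   the coordinates of [v *m W] are relaxed from [J] to [J2] one at a time. *)
Lemma lin_relax p r s (U : 'rV[S]_r -> Prop) (W : 'M[S]_(s, r)) j :
  (j <= r)%N -> (forall v, entries J2 v -> U v) -> entries (D 1) W ->
  (forall i v, entries (D i.+1) v -> U v ->
     exists2 c, entries (D i) c & entries J (v - c *m W)) ->
  lin J p.+1 (fun c : 'rV_s => entries J (c *m W)) ->
  lin J p.+1 (fun c : 'rV_s => forall k : 'I_r,
    if (k < j)%N then J2 ((c *m W) 0 k) else J ((c *m W) 0 k)).
Proof.
move=> jr J2U W1 genW; elim: j jr => [|j IH] jr linW.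
  apply: lin_ext linW => i v _; split=> [h k|h k k']; first exact: h.
  by rewrite [k]ord1; apply: h.
pose E : 'rV[S]_r := delta_mx 0 (Ordinal jr).
have EE (k : 'I_r) : E 0 k = (k == j :> nat)%:R by rewrite mxE eqxx.
(* [U] contains every row with entries in J2, so the quadric [w k 0] placed in coordinate [j] is a
   relation, that is, a combination of rows of [W] with linear coefficients. These coefficients are
   the new generators. *)
have rowX k : exists2 c, entries (D 1) c & entries J (w k 0 *: E - c *m W).
  apply: genW => [a b|]; last apply: J2U.
    rewrite !mxE; case: (_ && _); first by rewrite mulr1; apply: wD.
    by rewrite mulr0; apply: D0.
  by move=> a b; rewrite mxE mulrC; apply: idealM.
have [X0 X01 X0J] := fin_all_exists2 rowX.
pose X := \matrix_k X0 k.
have X1 : entries (D 1) X by move=> a b; rewrite mxE; apply: X01.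
have XJ : entries J (w *m E - X *m W).
  move=> a b; have := X0J a 0 b; congr (J _).
  rewrite !mxE big_ord1 !mxE; congr (_ - _).
  by apply: eq_bigr => l _; rewrite mxE.
have cXE (c : 'rV_q) (k : 'I_r) :
  J ((c *m w) 0 0 * (k == j :> nat)%:R - (c *m X *m W) 0 k).
  have := entries_idealMl idJ c XJ 0 k.
  by rewrite mulmxBr !mulmxA 2![in X in X -> _]mxE big_ord1 EE
    [X in J (_ + X) -> _]mxE [(c *m w) 0 0]mxE.
have sub j' : is_submod (fun c : 'rV_s => forall k : 'I_r,
    if (k < j')%N then J2 ((c *m W) 0 k) else J ((c *m W) 0 k)).
  split=> [k|c u v hu hv k].
    by rewrite mul0mx mxE; case: ifP => _; apply: ideal0.
  move: (hu k) (hv k); rewrite mulmxDl -scalemxAl !mxE.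
  by case: ifP => _ hu' hv'; apply: idealD => //; apply: idealM.
apply: (lin_quotient idJ (sub j) (sub j.+1) _ X1) => //.
- move=> v vJ k; have := ker_ideal idJ W vJ 0 k.
  by case: ifP => // _; apply: JJ2.
- move=> v h k; move: (h k); rewrite ltnS (leq_eqVlt k j).
  by case: eqP => [->|_ //]; rewrite ltnn; apply: JJ2.
- move=> l k; have := cXE (delta_mx 0 l) k.
  rewrite -!rowE ltnS (leq_eqVlt k j) !mxE; case: eqP => [_|_] /=.
    rewrite mulr1 => h; apply: idealBr idJ2 _ _ (JJ2 h) _.
    exact: wJ2.
  rewrite mulr0 sub0r => /(idealN idJ); rewrite opprK => h.
  by case: ifP => // _; apply: JJ2.
- move=> v v0 h k; move: (h k); rewrite ltnS (leq_eqVlt k j).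
  case: eqP => [->|_ //]; rewrite ltnn; apply: J2_deg1.
  by have := entriesDM v0 W1; apply.
- move=> i v vi h; have := h (Ordinal jr); rewrite ltnSn => hj.
  have [|c ci cJ] := genJ2 (i := i) _ hj.
    by have := entriesDM vi W1; rewrite addn1; apply.
  exists c => // k; have -> : ((v - c *m X) *m W) 0 k
      = (v *m W) 0 k - (c *m X *m W) 0 k.
    by rewrite mulmxBl [LHS]mxE [X in _ + X]mxE.
  move: (cXE c k) (h k).
  rewrite ltnS (leq_eqVlt k j).
  case: eqP => [kj|_] /=.
    rewrite mulr1 kj ltnn => h1 _.
    have kE : k = Ordinal jr by apply: val_inj.
    rewrite kE in h1 *; rewrite -(subrK ((c *m w) 0 0) ((v *m W) 0 _)) -addrA.
    exact: idealD.
  rewrite mulr0 sub0r => /(idealN idJ); rewrite opprK => h1.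
  by case: ifP => _ hk; apply: idealB => //; apply: JJ2.
- exact: IH (ltnW jr) linW.
(* Modulo J, [c *m X *m W] is the combination of quadrics [c *m w] in coordinate [j] and 0
   elsewhere: the relations of the rows of [X] over the previous stage are those of the quadrics. *)
- apply: lin_ext (linw p) => i c _; split=> [cJ k|/(_ (Ordinal jr))].
    have h : J ((c *m X *m W) 0 k).
      by apply: idealBr (cXE c k) _ => //; rewrite mulrC; apply: idealM.
    by case: ifP => // _; apply: JJ2.
  by have := cXE c (Ordinal jr); rewrite /= eqxx ltnn mulr1 => h;
    apply: idealBl.
Qed.

(** The generators [W] found over J serve over J2 as well; what changes is the syzygy module, now
    the rows c with [c *m W] in J2. By [lin_relax] it is still linear over J, and it contains all
    rows with entries in J2, so the induction applies to it. *)
Lemma lin_change p r (U : 'rV[S]_r -> Prop) :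
  is_submod U -> (forall v, entries J2 v -> U v) -> lin J p U -> lin J2 p U.
Proof.
elim: p r U => //= p IH r U sU J2U [U0 [s [W [W1 WU genW linW]]]]; split=> //.
exists s, W; split=> // [i v vi Uv|].
  by have [c ci cJ] := genW i v vi Uv; exists c => // a b; apply: JJ2.
apply: IH; [exact: submod_ker | exact: ker_ideal | case: p linW => [//|p] linW].
apply: lin_ext (lin_relax (leqnn r) J2U W1 genW linW) => i v _.
split=> [h a b|h k]; last by rewrite ltn_ord.
by have := h b; rewrite ltn_ord [a]ord1.
Qed.

End ChangeOfRings.

End LinearModules.

(** * Ideals given by lists of generators *)

Section GeneratedIdeals.
Variable S : comNzRingType.

(** The recursion isolates the coefficient of the head modulo the tail, the form suited to adjoining
    one generator at a time. [ideal_genP] identifies it with [ideal_gen]. *)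
Fixpoint igen (s : seq S) (f : S) : Prop :=
  if s is h :: t then exists c, igen t (f - c * h) else f = 0.

Lemma igen_ideal s : is_ideal (igen s).
Proof.
elim: s => [|h t [I0 ID]] /=; first by split=> // c a b -> ->;
  rewrite mulr0 addr0.
split=> [|c a b [ca Ha] [cb Hb]]; first by exists 0; rewrite mul0r subr0.
exists (c * ca + cb); have -> : c * a + b - (c * ca + cb) * h
  = c * (a - ca * h) + (b - cb * h); last exact: ID.
by rewrite mulrBr mulrDl opprD -mulrA addrACA.
Qed.
Hint Resolve igen_ideal : core.

Lemma igen_cons h t f : igen t f -> igen (h :: t) f.
Proof. by move=> tf; exists 0; rewrite mul0r subr0. Qed.

Lemma igen_head h t c : igen (h :: t) (c * h).
Proof. by exists c; rewrite subrr; apply: ideal0. Qed.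

Lemma igen_mem s h : h \in s -> igen s h.
Proof.
elim: s => //= a t IH; rewrite inE => /orP[/eqP->|/IH]; last exact: igen_cons.
by have := igen_head a t 1; rewrite mul1r.
Qed.

Lemma igen_min s (N : S -> Prop) :
  is_ideal N -> (forall h, h \in s -> N h) -> forall f, igen s f -> N f.
Proof.
move=> idN; elim: s => [_ f ->|h t IH sN f [c]] /=; first exact: ideal0.
move=> /IH ht; rewrite -(subrK (c * h) f); apply: idealD => //.
  by apply: ht => g gt; apply: sN; rewrite inE gt orbT.
by apply: idealM => //; apply: sN; rewrite inE eqxx.
Qed.

Lemma igen_sub s s' :
  (forall h, h \in s -> igen s' h) -> forall f, igen s f -> igen s' f.
Proof. exact: igen_min. Qed.

Lemma igen_subset s s' : {subset s <= s'} -> forall f, igen s f -> igen s' f.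
Proof. by move=> ss'; apply: igen_sub => h /ss'/igen_mem. Qed.

Lemma igen_ker (T : comNzRingType) (phi : {rmorphism S -> T}) s :
  (forall h, h \in s -> phi h = 0) -> forall f, igen s f -> phi f = 0.
Proof.
apply: igen_min; split=> [|c a b]; first exact: rmorph0.
by rewrite rmorphD rmorphM => -> ->; rewrite mulr0 addr0.
Qed.

(** Exchange in a regular sequence, in the direction that requires no grading: modulo t, f y = c h
    forces c = d y, and then y cancels from (f - d h) y. *)
Lemma igen_swap y h t f :
  (forall g, igen (y :: t) (g * h) -> igen (y :: t) g) ->
  (forall g, igen t (g * y) -> igen t g) ->
  igen (h :: t) (f * y) -> igen (h :: t) f.
Proof.
move=> hreg yreg [c tc].
have [|d td] := hreg c.
  exists f; rewrite -opprB; exact: idealN.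
exists d; apply: yreg.
have -> : (f - d * h) * y = f * y - c * h + (c - d * y) * h.
  by rewrite !mulrBl addrA subrK -!mulrA [h * y]mulrC.
by apply: idealD => //; rewrite mulrC; apply: idealM.
Qed.

End GeneratedIdeals.
#[local] Hint Resolve igen_ideal : core.

Lemma mpoly_subst_congr n (A B : comNzRingType)
    (phi psi : {rmorphism {mpoly A[n]} -> B}) (N : B -> Prop) :
  is_ideal N ->
  (forall c, N (phi c%:MP - psi c%:MP)) ->
  (forall i, N (phi 'X_i - psi 'X_i)) ->
  forall f, N (phi f - psi f).
Proof.
move=> idN NC NX.
have NM a b a' b' : N (a - a') -> N (b - b') -> N (a * b - a' * b').
  move=> ha hb; have -> : a * b - a' * b' = b * (a - a') + a' * (b - b').
    by rewrite !mulrBr [b * a]mulrC [b * a']mulrC addrA subrK.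
  by apply: idealD => //; apply: idealM.
elim/mpolyind=> [|c m p _ _ IH]; first by rewrite !rmorph0 subrr; apply: ideal0.
rewrite -mul_mpolyC !rmorphD !rmorphM opprD addrACA; apply: idealD => //.
apply: (NM) => //; rewrite mpolyXE_id !rmorph_prod.
elim/big_rec2: _ => [|i a b _ hab]; first by rewrite subrr; apply: ideal0.
apply: (NM _ _ _ _ _ hab); rewrite !rmorphXn; elim: (m i) => [|k IHk].
  by rewrite subrr; apply: ideal0.
by rewrite !exprS; apply: NM.
Qed.

(** * The bigrading, and modules over the diagonal *)

Section Bigraded.
Variables (K : fieldType) (n l : nat).
Local Notation R := {mpoly K[n]}.
Local Notation S := {mpoly {mpoly K[n]}[l]}.

Definition bihomog a b (f : S) :=
  f \is b.-homog /\ forall m, f@_m \is (a).-homog.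

Lemma bihomog0 a b : bihomog a b 0.
Proof. by split=> [|m]; rewrite ?mcoeff0 rpred0. Qed.

Lemma bihomogB a b f g : bihomog a b f -> bihomog a b g -> bihomog a b (f - g).
Proof. by move=> [fb fa] [gb ga]; split=> [|m]; rewrite ?mcoeffB rpredB. Qed.

Lemma bihomogD a b f g : bihomog a b f -> bihomog a b g -> bihomog a b (f + g).
Proof. by move=> [fb fa] [gb ga]; split=> [|m]; rewrite ?mcoeffD rpredD. Qed.

Lemma bihomogN a b f : bihomog a b f -> bihomog a b (- f).
Proof. by move=> [fb fa]; split=> [|m]; rewrite ?mcoeffN rpredN. Qed.

Lemma bihomogM a b c d f g :
  bihomog a b f -> bihomog c d g -> bihomog (a + c) (b + d) (f * g).
Proof.
move=> [fb fa] [gb ga]; split=> [|m]; first exact: dhomogM.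
by rewrite mcoeffM; apply: rpred_sum => k _; apply: dhomogM.
Qed.

Lemma bihomog_sum a b (I : Type) (r : seq I) (P : pred I) (F : I -> S) :
  (forall i, P i -> bihomog a b (F i)) -> bihomog a b (\sum_(i <- r | P i) F i).
Proof.
move=> h; elim/big_ind: _ => //; first exact: bihomog0.
exact: bihomogD.
Qed.

Lemma bihomogC a (c : R) : c \is (a).-homog -> bihomog a 0 c%:MP.
Proof.
move=> ca; split=> [|m].
  apply/dhomogP=> m; rewrite msuppC; case: ifP; rewrite // inE => _ /eqP->.
    exact: mdeg0.
by rewrite mcoeffC; case: eqP => _; rewrite ?mulr1 ?mulr0 ?rpred0.
Qed.

Lemma bihomog1 : bihomog 0 0 1.
Proof. by rewrite -mpolyC1; apply/bihomogC/dhomog1. Qed.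

Definition bicomp a b (f : S) : S :=
  map_mpoly (pihomog mdeg a) (pihomog mdeg b f).

Fact bicomp_is_additive a b : additive (bicomp a b).
Proof. by move=> f g; rewrite /bicomp pihomogB raddfB. Qed.

HB.instance Definition _ a b :=
  GRing.isAdditive.Build S S (bicomp a b) (bicomp_is_additive a b).

Lemma bicomp_id a b f : bihomog a b f -> bicomp a b f = f.
Proof.
move=> [fb fa]; rewrite /bicomp pihomog_dE //; apply/mpolyP=> m.
by rewrite mcoeff_map_mpoly /= pihomog_dE.
Qed.

Lemma bicomp_neq a b c d f :
  bihomog c d f -> (c != a) || (d != b) -> bicomp a b f = 0.
Proof.
move=> [fd fc] /orP[ca|db]; last by rewrite /bicomp (pihomog_ne0 db fd) raddf0.
apply/mpolyP=> m; rewrite mcoeff_map_mpoly mcoeff0 /=.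
have [e|ne] := eqVneq d b; last by rewrite (pihomog_ne0 ne fd) mcoeff0 pihomog0.
by rewrite -e (pihomog_dE fd) (pihomog_ne0 ca).
Qed.

Lemma bihomog_bicomp a b f : bihomog a b (bicomp a b f).
Proof.
split=> [|m]; last by rewrite mcoeff_map_mpoly /=; apply: pihomogP.
apply/dhomogP=> m; rewrite mcoeff_msupp mcoeff_map_mpoly /= => h; apply/eqP.
apply: contraNT h => ne.
by rewrite (dhomog_nemf_coeff (pihomogP mdeg b f) ne) pihomog0.
Qed.

Lemma bihomog_partition f : exists N, forall M, (N <= M)%N ->
  f = \sum_(a < M) \sum_(b < M) bicomp a b f.
Proof.
exists (maxn (msize f) (\max_(m <- msupp f) msize f@_m)) => M.
rewrite geq_max => /andP[fM cM].
apply/mpolyP=> m; rewrite raddf_sum /=.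
under eq_bigr => a _.
  rewrite raddf_sum /=.
  under eq_bigr => b _ do rewrite mcoeff_map_mpoly /=.
  rewrite -raddf_sum -raddf_sum -pihomog_partitionE //.
  over.
apply: pihomog_partitionE; have [mf|/memN_msupp_eq0->] := boolP (m \in msupp f).
  by apply: leq_trans cM; apply: leq_bigmax_seq.
by rewrite msize0.
Qed.

Lemma bicompM a b c d f h : bihomog c d h ->
  bicomp a b (f * h) =
    if (c <= a)%N && (d <= b)%N then bicomp (a - c) (b - d) f * h else 0.
Proof.
move=> hh; have [N /(_ N (leqnn N)) ->] := bihomog_partition f.
have hom i j : bicomp a b (bicomp i j f * h) =
    if (c <= a)%N && (d <= b)%N then
      bicomp (a - c) (b - d) (bicomp i j f) * h else 0.
  have ff := bihomog_bicomp i j f; have fh := bihomogM ff hh.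
  have [/andP[e1 e2]|ne] := boolP ((i + c == a)%N && (j + d == b)%N).
    move: fh; rewrite -(eqP e1) -(eqP e2) => fh.
    by rewrite (bicomp_id fh) !leq_addl !addnK (bicomp_id ff).
  rewrite (bicomp_neq fh) -?negb_and //; case: ifP => // /andP[ca db].
  rewrite (bicomp_neq ff) ?mul0r // -negb_and; apply: contra ne.
  by case/andP=> /eqP-> /eqP->; rewrite !subnK // !eqxx.
rewrite mulr_suml (raddf_sum (bicomp a b)).
move: hom; case: ((c <= a)%N && (d <= b)%N) => hom; last first.
  rewrite big1 // => i _; rewrite mulr_suml (raddf_sum (bicomp a b)).
  by rewrite big1 // => j _; apply: hom.
rewrite [X in _ = X * h]raddf_sum.
rewrite [RHS]mulr_suml.
apply: eq_bigr => i _.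
rewrite [X in bicomp _ _ X = _]mulr_suml.
rewrite [LHS]raddf_sum.
rewrite [X in _ = X * h]raddf_sum.
rewrite [RHS]mulr_suml.
by apply: eq_bigr => j _; apply: hom.
Qed.

Definition bihomogs (s : seq S) :=
  forall h, h \in s -> exists a b, bihomog a b h.

Lemma bihomogs_cons h t c d : bihomog c d h -> bihomogs t -> bihomogs (h :: t).
Proof.
by move=> hh tt g; rewrite inE => /orP[/eqP->|/tt//]; exists c, d.
Qed.

Lemma igen_bicomp s a b f : bihomogs s -> igen s f -> igen s (bicomp a b f).
Proof.
elim: s f => [|h t IH] f hs /=; first by move=> ->;
  rewrite (raddf0 (bicomp a b)).
have [c [d hh]] := hs h (mem_head _ _).
have ht : bihomogs t by move=> g gt; apply: hs; rewrite inE gt orbT.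
case=> e /(IH _ ht). rewrite (raddfB (bicomp a b)).
rewrite /= (bicompM _ _ _ hh).
case: (_ && _) => te; first by exists (bicomp (a - c) (b - d) e).
by apply: igen_cons; rewrite subr0 in te.
Qed.

(** Bihomogeneous generators make [igen t] stable under [bicomp], so a cofactor of [h] can be
    replaced by its component of the right bidegree. *)
Lemma igen_bihomog h t a b c d f :
  bihomogs t -> bihomog c d h -> bihomog (a + c) (b + d) f ->
  igen (h :: t) f -> exists2 e, bihomog a b e & igen t (f - e * h).
Proof.
move=> ht hh fh [e te]; exists (bicomp a b e); first exact: bihomog_bicomp.
have := igen_bicomp (a + c) (b + d) ht te.
by rewrite (raddfB (bicomp _ _)) /=
  (bicomp_id fh) (bicompM _ _ _ hh) !leq_addl !addnK.
Qed.

Lemma igen_bihomog_low h t a b c d f :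
  bihomogs t -> bihomog c d h -> bihomog a b f -> (a < c)%N || (b < d)%N ->
  igen (h :: t) f -> igen t f.
Proof.
move=> ht hh fh lt [e te]; have := igen_bicomp a b ht te.
rewrite (raddfB (bicomp a b)) /=
  (bicomp_id fh) (bicompM _ _ _ hh) (leqNgt c) (leqNgt d)
  -negb_or lt subr0.
by [].
Qed.

Lemma igen_cat_bihomog (s t : seq S) a b c d f :
  bihomogs t -> (forall h, h \in s -> bihomog c d h) ->
  bihomog (a + c) (b + d) f -> igen (s ++ t) f ->
  exists2 v : 'rV_(size s), entries (bihomog a b) v
    & igen t (f - (v *m \col_i s`_i) 0 0).
Proof.
move=> ht; elim: s f => [|h s IH] f hs fh /= tf.
  exists 0; first by move=> i j; rewrite mxE; apply: bihomog0.
  by rewrite mxE big_ord0 subr0.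
have hh := hs h (mem_head _ _).
have hs' g : g \in s -> bihomog c d g by move=> gs; apply: hs;
  rewrite inE gs orbT.
have hst : bihomogs (s ++ t).
  by move=> g; rewrite mem_cat => /orP[/hs' gg|/ht//]; exists c, d.
have [e ee se] := igen_bihomog hst hh fh tf.
have [v vv tv] := IH _ hs' (bihomogB fh (bihomogM ee hh)) se.
have wE : entries (bihomog a b) (row_mx e%:M v).
  by apply/entries_row_mx; split=> // i j; rewrite !ord1 mxE eqxx mulr1n;
    exact: ee.
exists (row_mx e%:M v); first exact: wE.
have -> : \col_(i < (size s).+1) (h :: s)`_i
    = col_mx h%:M (\col_i s`_i) :> 'cV_(1 + size s).
  apply/colP=> i; rewrite !mxE; case: splitP => j ij; rewrite !mxE ij.
    by rewrite !ord1 eqxx.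
  by [].
have -> : (row_mx e%:M v *m col_mx h%:M (\col_i s`_i)) 0 0
    = e * h + (v *m \col_i s`_i) 0 0.
  by rewrite mul_row_col -scalar_mxM [LHS]mxE [X in X + _]mxE eqxx mulr1n.
by rewrite opprD addrA.
Qed.

Let D0 i : bihomog i i 0 := bihomog0 i i.
Let DB i a b : bihomog i i a -> bihomog i i b -> bihomog i i (a - b) :=
  @bihomogB i i a b.
Let DM i j a b : bihomog i i a -> bihomog j j b ->
    bihomog (i + j) (i + j) (a * b) :=
  @bihomogM i i j j a b.

Definition comb (s : seq S) (v : 'rV[S]_(size s)) : S := (v *m \col_i s`_i) 0 0.

Definition relations (N : S -> Prop) (s : seq S) (v : 'rV[S]_(size s)) :=
  N (comb v).
Arguments relations : clear implicits.

(* Generation over the diagonal subalgebra, which has degrees (i, i). *)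
Definition spans (N : S -> Prop) a b (s : seq S) :=
  (forall h, h \in s -> bihomog a b h) /\
  forall i f, bihomog (i + a) (i + b) f ->
    exists2 v : 'rV_(size s), entries (bihomog i i) v & N (f - comb v).

(* The module with generators s and relations in N is linear up to step p over
   the quotient by J of the diagonal subalgebra. *)
Definition linear_upto (J : S -> Prop) p (N : S -> Prop) (s : seq S) :=
  lin (fun i => bihomog i i) J p (relations N s).

Lemma comb_bihomog i a b s (v : 'rV_(size s)) :
  entries (bihomog i i) v -> (forall h, h \in s -> bihomog a b h) ->
  bihomog (i + a) (i + b) (comb v).
Proof.
move=> vi hs; rewrite /comb mxE; apply: bihomog_sum => k _.
by apply: bihomogM; [apply: vi | rewrite mxE; apply/hs/mem_nth].
Qed.

Lemma combP s c (u v : 'rV_(size s)) : comb (c *: u + v) = c * comb u + comb v.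
Proof. by rewrite /comb mulmxDl -scalemxAl [LHS]mxE [X in X + _]mxE. Qed.

Lemma combB s (u v : 'rV_(size s)) : comb (u - v) = comb u - comb v.
Proof. by rewrite addrC -scaleN1r combP mulN1r addrC. Qed.

Lemma comb1 (v : 'rV_(size [:: 1 : S])) : comb v = v 0 0.
Proof. by rewrite /comb mxE big_ord1 mxE mulr1. Qed.

Lemma comb_mul q s (c : 'rV_q) (X : 'M_(q, size s)) :
  comb (c *m X) = \sum_k c 0 k * comb (row k X).
Proof.
rewrite /comb -mulmxA mxE; apply: eq_bigr => k _; congr (_ * _).
by rewrite -row_mul !mxE.
Qed.

Lemma comb_cons h s (u : 'M_1) (v : 'rV_(size s)) :
  comb (row_mx u v : 'rV_(size (h :: s))) = u 0 0 * h + comb v.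
Proof.
rewrite /comb; have -> : \col_(i < (size s).+1) (h :: s)`_i
    = col_mx h%:M (\col_i s`_i) :> 'cV_(1 + size s).
  apply/colP=> i; rewrite !mxE; case: splitP => j ij; rewrite !mxE ij.
    by rewrite !ord1 eqxx.
  by [].
have -> : u 0 0 * h = (u *m h%:M) 0 0 by rewrite mul_mx_scalar mxE mulrC.
have E : row_mx u v *m col_mx h%:M (\col_i s`_i) = u *m h%:M + v *m \col_i s`_i.
  exact: mul_row_col.
by have := congr1 (fun M : 'M_1 => M 0 0) E; rewrite [X in _ = X -> _]mxE.
Qed.

Lemma submod_relations N s : is_ideal N -> is_submod (relations N s).
Proof.
move=> idN; split=> [|c u v]; rewrite /relations.
  by rewrite /comb mul0mx mxE; apply: ideal0.
by rewrite combP; case: idN => _; apply.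
Qed.

Lemma relations_ideal J N s (v : 'rV_(size s)) : is_ideal J ->
  (forall f, J f -> N f) -> entries J v -> relations N s v.
Proof. by move=> idJ JN /(entries_idealMr idJ) vJ; apply/JN/vJ. Qed.

Lemma linear_upto_ext J p N N' s a b :
  (forall h, h \in s -> bihomog a b h) ->
  (forall i f, bihomog (i + a) (i + b) f -> N f <-> N' f) ->
  linear_upto J p N s -> linear_upto J p N' s.
Proof.
move=> hs NN'; apply: lin_ext => i v vi; apply: (NN' i).
exact: comb_bihomog.
Qed.

(* If N1 = (N : h), multiplication by h identifies the module of N1 with the
   kernel of S/N -> S/(h, N). *)
Lemma linear_quotient J t h N1 a b a1 b1 c d s s1 p :
  is_ideal J -> is_ideal N1 -> (forall f, J f -> igen t f) -> bihomogs t ->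
  bihomog c d h -> (a1 + c)%N = a.+1 -> (b1 + d)%N = b.+1 ->
  (a < c)%N || (b < d)%N ->
  spans (igen t) a b s -> spans N1 a1 b1 s1 ->
  (forall i f, bihomog (i + a1) (i + b1) f -> N1 f <-> igen t (f * h)) ->
  linear_upto J p.+1 (igen t) s -> linear_upto J p N1 s1 ->
  linear_upto J p.+1 (igen (h :: t)) s.
Proof.
move=> idJ idN1 Jt ht hh ac bd low [sb sgen] [s1b s1gen] N1P lint lin1.
(* The equations on bidegrees put the products of [s1] with [h] exactly one diagonal step above [s],
   so their coordinates on [s] are linear. *)
have rowX (k : 'I_(size s1)) :
    exists2 v : 'rV_(size s), entries (bihomog 1 1) v
      & igen t (s1`_k * h - comb v).
  by apply: sgen; rewrite !add1n -ac -bd; apply: bihomogM => //;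
    apply/s1b/mem_nth.
have [X0 X01 X0t] := fin_all_exists2 rowX.
pose X := \matrix_k X0 k.
have rX k : row k X = X0 k by apply/rowP=> j; rewrite !mxE.
have X1 : entries (bihomog 1 1) X by move=> i j; rewrite mxE; apply: X01.
have cX (e : 'rV_(size s1)) : igen t (comb e * h - comb (e *m X)).
  rewrite comb_mul {1}/comb mxE mulr_suml -sumrB.
  elim/big_ind: _ => [||k _]; first exact: ideal0.
    by move=> x y; apply: idealD.
  rewrite [X in _ * X * h]mxE -mulrA -mulrBr rX; apply: idealM => //;
    exact: X0t.
rewrite /linear_upto.
have H := @lin_quotient _ _ D0 DB DM J idJ p _ _ (relations (igen t) s)
  (relations (igen (h :: t)) s) X.
apply: H.
- exact: submod_relations.
- exact: submod_relations.
- by move=> v; apply: relations_ideal.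
- exact: X1.
- by move=> v; apply: igen_cons.
- move=> k; rewrite /relations rX;
    apply: (idealBr _ (igen_cons h (X0t k))) => //.
  exact: igen_head.
(* By [low], [h] has no nonzero multiple in the bidegree of [s], so no relation of degree 0 is
   added. *)
- move=> v v0; apply: (igen_bihomog_low ht hh _ low).
  exact: (comb_bihomog v0 sb).
- move=> i v vi; rewrite /relations => hv.
  have fv : bihomog (i + a1 + c) (i + b1 + d) (comb v).
    by rewrite -!addnA ac bd !addnS -!addSn; apply: comb_bihomog.
  have [e ei te] := igen_bihomog ht hh fv hv.
  have [w wi we] := s1gen _ _ ei; exists w; first exact: wi.
  have fe : bihomog (i + a1) (i + b1) (e - comb w).
    by apply: bihomogB => //; apply: comb_bihomog.
  move/(N1P _ _ fe): we => we; rewrite combB.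
  have -> : comb v - comb (w *m X) = (comb v - e * h) + (e - comb w) * h
      + (comb w * h - comb (w *m X)).
    by rewrite mulrBl !addrA !subrK.
  by apply: idealD => //; apply: idealD.
- exact: lint.
- apply: lin_ext lin1 => i e ei; rewrite /relations.
  rewrite (N1P i); last exact: comb_bihomog.
  by split=> H; [apply: idealBr (cX e) H | apply: idealBl (cX e) H].
Qed.

(** The multiples of [h] form a copy of S/N1, where [N1] is (t : h) on the diagonal; modulo them the
    other generators [s] live in S/(h, t). The horseshoe lemma joins the two. *)
Lemma linear_extension J t h N1 c d s p :
  is_ideal J -> is_ideal N1 -> (forall f, J f -> igen t f) -> bihomogs t ->
  bihomog c d h -> (forall g, g \in s -> bihomog c d g) ->
  (forall i f, bihomog i i f -> N1 f <-> igen t (f * h)) ->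
  linear_upto J p N1 [:: 1] -> linear_upto J p (igen (h :: t)) s ->
  linear_upto J p (igen t) (h :: s).
Proof.
move=> idJ idN1 Jt ht hh hs N1P lin1 linh.
rewrite /linear_upto.
have H := @lin_extension _ _ D0 DB DM J idJ p 1 (size s)
  (relations (igen t) (h :: s)) (relations N1 [:: 1])
  (relations (igen (h :: t)) s).
apply: H.
- exact: (submod_relations (h :: s) (igen_ideal t)).
- by move=> v vJ; apply: (relations_ideal (s := h :: s) idJ Jt vJ).
- move=> i v vi; rewrite /relations (comb_cons h) comb1.
  have -> : comb (0 : 'rV_(size s)) = 0 by rewrite /comb mul0mx mxE.
  by rewrite addr0 (N1P i).
- move=> i v vi hv; have [e ei te] :=
    igen_bihomog ht hh (comb_bihomog vi hs) hv.
  exists (- e%:M); first by move=> j k; rewrite !ord1 !mxE eqxx mulr1n;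
    apply: bihomogN.
  by rewrite /relations (comb_cons h) !mxE eqxx mulr1n mulNr addrC.
- move=> i u v ui vi; rewrite /relations (comb_cons h) => tv.
  by exists (- u 0 0); rewrite mulNr opprK addrC.
- exact: lin1.
- exact: linh.
Qed.

(** As [h] has bidegree (2, 1), a factor of bidegree (0, 1) is what brings it to (2, 2). On the
    diagonal the products of [s1] with [h] generate (h, t) modulo t, and their relations are those
    of [s1] over (t : h). *)
Lemma linear_change t h N1 s1 :
  bihomogs t -> bihomog 2 1 h -> is_ideal N1 -> spans N1 0 1 s1 ->
  (forall i f, bihomog (i + 0) (i + 1) f -> N1 f <-> igen t (f * h)) ->
  (forall p, linear_upto (igen t) p N1 s1) ->
  forall p N s, is_ideal N -> (forall f, igen (h :: t) f -> N f) ->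
  linear_upto (igen t) p N s -> linear_upto (igen (h :: t)) p N s.
Proof.
move=> ht hh idN1 [s1b s1gen] N1P lin1 p N s idN tN.
pose w : 'cV_(size s1) := \col_k (s1`_k * h).
have cw (c : 'rV_(size s1)) : (c *m w) 0 0 = comb c * h.
  rewrite /comb [LHS]mxE [X in _ = X * h]mxE mulr_suml; apply: eq_bigr => k _.
  by rewrite [w _ _]mxE [X in _ = _ * X * h]mxE mulrA.
move=> linN; rewrite /linear_upto.
have H := @lin_change _ _ D0 DB DM (igen t) (igen (h :: t)) (igen_ideal _)
  (igen_ideal _) (size s1) w.
apply: H.
- by move=> f; apply: igen_cons.
- move=> i j; rewrite mxE; apply: (bihomogM (a := 0) (b := 1) _ hh).
  exact/s1b/mem_nth.
- by move=> i j; rewrite mxE; apply: igen_head.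
- move=> i f fi hf.
  have fi' : bihomog (i + 0 + 2) (i + 1 + 1) f by rewrite addn0 -addnA addn2.
  have [e ei te] := igen_bihomog ht hh fi' hf.
  have [c ci ce] := s1gen _ _ ei; exists c; first exact: ci.
  have fe : bihomog (i + 0) (i + 1) (e - comb c).
    by apply: bihomogB => //; apply: comb_bihomog.
  move/(N1P _ _ fe): ce => ce; rewrite cw.
  have -> : f - comb c * h = (f - e * h) + (e - comb c) * h.
    by rewrite mulrBl addrA subrK.
  exact: idealD.
- by move=> f f1; apply: (igen_bihomog_low ht hh f1).
- move=> q; apply: lin_ext (lin1 q) => i c ci; rewrite cw -(N1P i) //.
  exact: comb_bihomog.
- exact: submod_relations.
- by move=> v; apply: relations_ideal.
- exact: linN.
Qed.

End Bigraded.

#[local] Arguments igen : simpl never.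

Lemma mpoly_integral (A : idomainType) m (f g : {mpoly A[m]}) :
  f * g = 0 -> g <> 0 -> f = 0.
Proof. by move=> /eqP; rewrite mulf_eq0 => /orP[/eqP|/eqP]. Qed.

(** * Quotients by variables, and the Segre product *)

Section Variables.
Variables (K : fieldType) (n l : nat).
Local Notation R := {mpoly K[n]}.
Local Notation S := {mpoly {mpoly K[n]}[l]}.
Local Notation V := ('I_n + 'I_l)%type.

Definition var (v : V) : S :=
  match v with inl k => ('X_k)%:MP | inr j => 'X_j end.

Definition isx (v : V) := if v is inl _ then true else false.

Lemma bihomog_var v : bihomog (isx v) (~~ isx v) (var v).
Proof.
case: v => [k|j] /=; first by apply: bihomogC; rewrite dhomogX /= mdeg1.
split=> [|m]; first by rewrite dhomogX /= mdeg1.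
by rewrite mcoeffX; case: eqP => _;
  rewrite ?rpred0 // -mpolyC1 -alg_mpolyC rpredZ // dhomog1.
Qed.

Lemma bihomogs_var Z : bihomogs (map var Z).
Proof.
by move=> h /mapP[v _ ->]; exists (isx v), (~~ isx v); apply: bihomog_var.
Qed.

Lemma bipoly_congr (B : comNzRingType) (phi psi : {rmorphism S -> B})
    (N : B -> Prop) : is_ideal N ->
  (forall c : K, phi c%:MP%:MP = psi c%:MP%:MP) ->
  (forall v, N (phi (var v) - psi (var v))) -> forall f, N (phi f - psi f).
Proof.
move=> idN phipsi Nv; apply: mpoly_subst_congr => // [c|j];
  last exact: (Nv (inr j)).
apply: (mpoly_subst_congr (phi := phi \o @mpolyC l _)
  (psi := psi \o @mpolyC l _)).
- exact: idN.
- by move=> a /=; rewrite phipsi subrr; apply: ideal0.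
- by move=> k; apply: (Nv (inl k)).
Qed.

Definition subst (u : V -> S) : S -> S :=
  mmap (mmap (@mpolyC l _ \o @mpolyC n _) (fun k => u (inl k)))
    (fun j => u (inr j)).

HB.instance Definition _ u := GRing.RMorphism.on (subst u).

Lemma substC u (c : K) : subst u c%:MP%:MP = c%:MP%:MP.
Proof. by rewrite /subst mmapC /= mmapC. Qed.

Lemma subst_var u v : subst u (var v) = u v.
Proof.
by case: v => [k|j]; rewrite /subst /= ?mmapC /= mmapX mmap1U.
Qed.

Lemma is_ideal0 (B : comNzRingType) : is_ideal (fun f : B => f = 0).
Proof. by split=> // c a b -> ->; rewrite mulr0 addr0. Qed.

Lemma subst_congr (N : S -> Prop) u u' : is_ideal N ->
  (forall v, N (u v - u' v)) -> forall f, N (subst u f - subst u' f).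
Proof.
move=> idN Nu.
have H := @bipoly_congr _ (subst u) (subst u') N idN; apply: H.
  by move=> c; rewrite /= !substC.
by move=> v /=; rewrite !subst_var.
Qed.

Lemma subst_id f : subst var f = f.
Proof.
have H := @bipoly_congr _ (subst var) idfun _ (is_ideal0 _).
apply/eqP; rewrite -subr_eq0; apply/eqP; apply: H => [c|v].
  by rewrite /= substC.
by rewrite /= subst_var subrr.
Qed.

(** An endomorphism whose kernel is the ideal of the variables in [Z] ([igen_varsP]). Quotients by
    variables are thus realized inside the domain S, where an element is regular as soon as its
    image is nonzero. *)
Definition kill (Z : seq V) := subst (fun v => if v \in Z then 0 else var v).

HB.instance Definition _ Z := GRing.RMorphism.on (kill Z).

Lemma kill_var Z v : kill Z (var v) = if v \in Z then 0 else var v.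
Proof. exact: subst_var. Qed.

Lemma igen_kill Z f : igen (map var Z) (f - kill Z f).
Proof.
rewrite -{1}[f]subst_id; apply: subst_congr => // v.
case: ifP => vZ; last by rewrite subrr; apply: ideal0.
by rewrite subr0; apply: igen_mem; apply: map_f.
Qed.

Lemma igen_varsP Z f : igen (map var Z) f <-> kill Z f = 0.
Proof.
split=> [|f0]; last by have := igen_kill Z f; rewrite f0 subr0.
apply: (igen_ker (phi := kill Z)) => h /mapP[v vZ ->] /=.
by rewrite kill_var vZ.
Qed.

Lemma bipoly_integral (f g : S) : f * g = 0 -> g <> 0 -> f = 0.
Proof. exact: mpoly_integral. Qed.

Lemma igen_vars_reg Z f h : kill Z h <> 0 ->
  igen (map var Z) (f * h) -> igen (map var Z) f.
Proof.
move=> h0 /igen_varsP; rewrite (rmorphM (kill Z)) => fh.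
exact/igen_varsP/(bipoly_integral fh).
Qed.

Lemma var_neq0 v : var v <> 0.
Proof.
apply/eqP; case: v => [k|j] /=; rewrite ?mpolyC_eq0.
  by rewrite -msize_poly_eq0 msizeX.
by rewrite -msize_poly_eq0 msizeX.
Qed.

Lemma igen_vars_regP Z f v : v \notin Z ->
  igen (map var Z) f <-> igen (map var Z) (f * var v).
Proof.
move=> vZ; split=> [|]; first by rewrite mulrC; apply: idealM.
by apply: igen_vars_reg; rewrite kill_var (negPf vZ); apply: var_neq0.
Qed.

Lemma mmap_homog0 m (A : nzRingType) (B : comNzRingType) (phi : A -> B) d
    (p : {mpoly A[m]}) h :
  p \is d.+1.-homog -> (forall i, h i = 0) -> mmap phi h p = 0.
Proof.
move=> hp h0; rewrite /mmap big_seq big1 // => u up.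
have /= := dhomog_mf hp up; rewrite mdegE => du.
have [i ui] : exists i, u i != 0%N.
  apply/existsP; apply: contra_eqT du; rewrite negb_exists => /forallP u0.
  by rewrite big1 // => i _; apply/eqP; rewrite -[_ == _]negbK.
rewrite /mmap1 (bigD1 i) //=.
by rewrite h0 expr0n (negPf ui) mul0r mulr0.
Qed.

(** Every monomial of [f] contains a variable of the side [s], the x's for [true]. Read as a number,
    [s] raises just one of the two degrees. *)
Lemma igen_side (s : bool) a b f Z :
  (forall v, isx v = s -> v \in Z) ->
  bihomog (a + s) (b + ~~ s) f -> igen (map var Z) f.
Proof.
move=> sZ [fb fa]; apply/igen_varsP; rewrite /kill /subst.
case: s sZ fb fa => /= sZ fb fa; rewrite ?addn1 in fb fa.
  rewrite {1}/mmap big1 // => m _.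
  have -> : mmap (@mpolyC l R \o @mpolyC n K)
      (fun k => if inl k \in Z then 0 else var (inl k)) f@_m = 0.
    by apply: mmap_homog0 (fa m) _ => k; rewrite sZ.
  by rewrite mul0r.
by apply: mmap_homog0 fb _ => j; rewrite sZ.
Qed.

Lemma spans1 (N : S -> Prop) : is_ideal N -> spans N 0 0 [:: 1].
Proof.
move=> idN; split=> [h|i f]; first by rewrite inE => /eqP->; apply: bihomog1.
rewrite !addn0 => fi; exists (const_mx f); first by move=> j k; rewrite mxE.
by rewrite comb1 mxE subrr; apply: ideal0.
Qed.

Lemma spans_le (N N' : S -> Prop) a b s :
  (forall f, N f -> N' f) -> spans N a b s -> spans N' a b s.
Proof.
move=> NN' [sb sgen]; split=> // i f /sgen[v vi vN].
by exists v => //; apply: NN'.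
Qed.

Lemma spans_vars Z (s : bool) a :
  (forall v, v \in a -> isx v = s) ->
  (forall v, isx v = s -> v \in a ++ Z) ->
  spans (igen (map var Z)) s (~~ s) (map var a).
Proof.
move=> sa aZ; have ha h : h \in map var a -> bihomog s (~~ s) h.
  by case/mapP=> v /sa <- ->; apply: bihomog_var.
split=> // i f fi.
have := igen_side aZ fi; rewrite map_cat.
exact: igen_cat_bihomog (@bihomogs_var Z) ha fi.
Qed.

Lemma linear_upto_eq J p (N N' : S -> Prop) s :
  (forall f, N f <-> N' f) -> linear_upto J p N s -> linear_upto J p N' s.
Proof. by move=> NN'; apply: lin_ext => i v _; apply: NN'. Qed.

Lemma linear_upto_free p t : (forall c, bihomog 0 0 c -> igen t c -> c = 0) ->
  linear_upto (igen t) p (igen t) [:: 1 : S].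
Proof.
move=> t0; apply: (lin_free (fun i => @bihomog0 K n l i i) (igen_ideal t)).
- move=> v v0; rewrite /relations comb1 => tv; apply/rowP=> j; rewrite ord1 mxE.
  by apply: t0 => //; apply: v0.
- by move=> i v _; rewrite /relations comb1 => tv j k; rewrite !ord1.
Qed.

Definition alive (s : bool) (Z : seq V) :=
  [seq v <- enum {: V} | (isx v == s) && (v \notin Z)].

Lemma mem_alive (s : bool) Z v : (v \in alive s Z) =
    (isx v == s) && (v \notin Z).
Proof. by rewrite mem_filter mem_enum andbT. Qed.

Lemma spans_alive (s : bool) Z :
    spans (igen (map var Z)) s (~~ s) (map var (alive s Z)).
Proof.
apply: spans_vars => v; first by rewrite mem_alive => /andP[/eqP].
by move=> vs; rewrite mem_cat mem_alive vs eqxx; case: (v \in Z).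
Qed.

(* Modules over the Segre product of the two polynomial rings: quotients by
   variables, and their twists by one variable of either kind. *)
Lemma segre_linear p :
  (forall Z, linear_upto (igen [::]) p (igen (map var Z)) [:: 1]) /\
  (forall (s : bool) Z a, uniq a ->
    (forall v, (v \in a) = (isx v == s) && (v \notin Z)) ->
     linear_upto (igen [::]) p (igen (map var Z)) (map var a)).
Proof.
elim: p => [|p [_ IH]]; first by [].
(* Cyclic modules suffice: a twist is filtered by its generators, where [h] spans a copy of S/(Z) by
   regularity and the remaining variables live modulo [h]. *)
suff lin1 Z : linear_upto (igen [::]) p.+1 (igen (map var Z)) [:: 1].
  split=> // s Z a; elim: a Z => [|h a IHa] Z /=.
    move=> _ _; apply: (lin_free (fun i => @bihomog0 K n l i i)
      (igen_ideal [::])).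
      by move=> v _ _; apply: thinmx0.
    by move=> i v _ _ j [].
  case/andP=> ha ua aE.
  have /andP[/eqP hs hZ] : (isx h == s) && (h \notin Z) by rewrite -aE mem_head.
  apply: (linear_extension (N1 := igen (map var Z)) _ _ _ _ (bihomog_var h))
    => //.
  - by apply: igen_subset.
  - exact: bihomogs_var.
  - move=> g /mapP[v va ->]; rewrite hs; have := bihomog_var v.
    by have := aE v; rewrite inE va orbT => /esym/andP[/eqP-> _].
  - by move=> i f _; apply: igen_vars_regP.
  - apply: (IHa (h :: Z)) => // v; rewrite inE negb_or.
    have := aE v; rewrite inE; case: eqP => [->|_] /=; last by [].
    by rewrite (negPf ha) andbF.
elim: Z => [|h Z IHZ].
  by apply: linear_upto_free => c _; apply.
have [hZ|hZ] := boolP (h \in Z).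
  apply: linear_upto_eq IHZ => f; split; apply: igen_subset => g; rewrite ?inE.
    by move=> ->; rewrite orbT.
  by case/orP=> [/eqP->|//]; apply: map_f.
(* Multiplication by [h] raises one of the two degrees, and a variable of the other kind completes
   it to (1, 1). The kernel is therefore a twist of S/(Z), linear up to step p by induction. *)
apply: (linear_quotient (N1 := igen (map var Z)) (a := 0) (b := 0)
  (a1 := ~~ isx h) (b1 := ~~ ~~ isx h) (s1 := map var (alive (~~ isx h) Z))
  _ _ _ _ (bihomog_var h)) => //.
- by apply: igen_subset.
- exact: bihomogs_var.
- by case: (isx h).
- by case: (isx h).
- by case: (isx h).
- exact: spans1.
- exact: spans_alive.
- by move=> i f _; apply: igen_vars_regP.
- apply: IH => [|v]; last exact: mem_alive.
  by rewrite filter_uniq // enum_uniq.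
Qed.

End Variables.

(** * Ideals with few generators, and ideals extended from the coefficients *)

Lemma igen_self (A : comNzRingType) (h : A) t : igen (h :: t) h.
Proof. by have := igen_head h t 1; rewrite mul1r. Qed.

Lemma igen1P (A : comNzRingType) (h f : A) :
  igen [:: h] f <-> exists c, f = c * h.
Proof.
split=> [[c /eqP]|[c ->]]; last exact: igen_head.
by rewrite subr_eq0 => /eqP ->; exists c.
Qed.

Lemma igen2P (A : comNzRingType) (h k f : A) :
  igen [:: h; k] f <-> exists c d, f = c * h + d * k.
Proof.
split=> [[c /igen1P[d e]]|[c [d ->]]].
  by exists c, d; rewrite -e addrC subrK.
by exists c; rewrite addrC addKr; apply: igen_head.
Qed.

Section ConstantCoefficients.
Variables (A : comNzRingType) (m : nat).

Lemma igen_coef (s : seq A) (f : {mpoly A[m]}) :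
  igen (map (@mpolyC m A) s) f <-> forall u, igen s f@_u.
Proof.
split=> [|fs].
  elim: s f => [|h s IH] f /=; first by move=> -> u; rewrite mcoeff0.
  case=> c fs u; exists c@_u; have := IH _ fs u.
  by rewrite mcoeffB mulrC mcoeffCM mulrC.
rewrite [f]mpolyE; elim/big_ind: _ => [||u _]; first exact: ideal0.
  by move=> a b; apply: idealD.
rewrite -mul_mpolyC mulrC; apply: idealM => //.
have id : is_ideal (fun a : A => igen (map (@mpolyC m A) s) a%:MP).
  split=> [|c a b]; first by rewrite mpolyC0; apply: ideal0.
  by rewrite mpolyCD mpolyCM; case: (igen_ideal (map (@mpolyC m A) s)) => _;
    apply.
by apply: igen_min id _ _ (fs u) => h hs; apply/igen_mem/map_f.
Qed.

Lemma igen_coef_reg s (c : A) (f : {mpoly A[m]}) :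
  (forall a, igen s (a * c) -> igen s a) ->
  igen (map (@mpolyC m A) s) (f * c%:MP) -> igen (map (@mpolyC m A) s) f.
Proof.
move=> creg /igen_coef fc; apply/igen_coef => u; apply: creg.
by have := fc u; rewrite mulrC mcoeffCM mulrC.
Qed.

Lemma mcoeffMX0 (f : {mpoly A[m]}) j (u : 'X_{1..m}) : u j = 0%N ->
    (f * 'X_j)@_u = 0.
Proof.
move=> uj; apply: memN_msupp_eq0; rewrite (perm_mem (msuppMX _ _)).
apply/mapP=> -[v _ uE]; move: uj.
by rewrite uE mnmDE mnm1E eqxx.
Qed.

(* The coefficient of f(c y_k - d y_j) at y_k y^u is c f_u minus a coefficient
   of smaller degree in y_j. *)
Lemma igen_linear_reg s c d (j k : 'I_m) (f : {mpoly A[m]}) :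
  j != k -> (forall a, igen s (a * c) -> igen s a) ->
  igen (map (@mpolyC m A) s) (f * (c%:MP * 'X_k - d%:MP * 'X_j)) ->
  igen (map (@mpolyC m A) s) f.
Proof.
move=> jk creg /igen_coef fs; apply/igen_coef => u.
have [N] := ubnP (u j); elim: N u => // N IH u /ltnSE uN; apply: creg.
have := fs (U_(k) + u)%MM.
have -> : f * (c%:MP * 'X_k - d%:MP * 'X_j)
    = c%:MP * (f * 'X_k) - d%:MP * (f * 'X_j) by ring.
rewrite mcoeffB !mcoeffCM mcoeffMX => fu; rewrite mulrC.
apply: idealBl fu _ => //; apply: idealM => //.
have [u0|u0] := eqVneq (u j) 0%N.
  rewrite mcoeffMX0; first exact: ideal0.
  by rewrite mnmDE mnm1E u0 eq_sym (negPf jk).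
have -> : (U_(k) + u)%MM = (U_(j) + (U_(k) + (u - U_(j))))%MM.
  rewrite addmC [RHS]addmC -addmA [(_ + U_(j))%MM]submK ?lep1mP //.
  by rewrite addmC.
rewrite mcoeffMX; apply: IH.
rewrite mnmDE mnmBE !mnm1E eqxx eq_sym (negPf jk) add0n subn1.
by rewrite prednK ?lt0n.
Qed.

End ConstantCoefficients.

(** * The ideals of minors: regular elements, colon ideals, kernel *)

Section Determinantal.
Variables (K : fieldType) (n : nat).
Local Notation R := {mpoly K[n]}.
Local Notation S := {mpoly {mpoly K[n]}[3]}.
Variables (g1 g2 g3 : R).
Hypotheses (g1h : g1 \is 2.-homog) (g2h : g2 \is 2.-homog)
    (g3h : g3 \is 2.-homog).
Hypotheses (g1_neq0 : g1 <> 0)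
  (g2_reg : forall f, igen [:: g1] (f * g2) -> igen [:: g1] f)
  (g3_reg : forall f, igen [:: g2; g1] (f * g3) -> igen [:: g2; g1] f).

Let i1 : 'I_3 := @Ordinal 3 0 isT.
Let i2 : 'I_3 := @Ordinal 3 1 isT.
Let i3 : 'I_3 := @Ordinal 3 2 isT.
Let v1 : 'I_n + 'I_3 := inr i1.
Let v2 : 'I_n + 'I_3 := inr i2.
Let v3 : 'I_n + 'I_3 := inr i3.
Let y1 : S := 'X_i1.
Let y2 : S := 'X_i2.
Let y3 : S := 'X_i3.
Let h1 : S := g1%:MP.
Let h2 : S := g2%:MP.
Let h3 : S := g3%:MP.
Let m12 := h1 * y2 - h2 * y1.
Let m13 := h1 * y3 - h3 * y1.
Let m23 := h2 * y3 - h3 * y2.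

Lemma ord3P (P : 'I_3 -> Prop) : P i1 -> P i2 -> P i3 -> forall j, P j.
Proof.
move=> P1 P2 P3 [[|[|[|j]]] lj]; last by [].
- by rewrite (_ : Ordinal lj = i1) //; apply: val_inj.
- by rewrite (_ : Ordinal lj = i2) //; apply: val_inj.
- by rewrite (_ : Ordinal lj = i3) //; apply: val_inj.
Qed.

Lemma h1_neq0 : h1 <> 0.
Proof. by apply/eqP; rewrite mpolyC_eq0; apply/eqP. Qed.

Lemma y_neq0 j : 'X_j <> 0 :> S.
Proof. exact: (@var_neq0 K n 3 (inr j)). Qed.

Lemma bihomog_y j : bihomog 0 1 ('X_j : S).
Proof. exact: (@bihomog_var K n 3 (inr j)). Qed.

Lemma bihomog_h g : g \is 2.-homog -> bihomog 2 0 (g%:MP : S).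
Proof. exact: bihomogC. Qed.

Lemma bihomog_minor g g' i j : g \is 2.-homog -> g' \is 2.-homog ->
  bihomog 2 1 (g%:MP * 'X_i - g'%:MP * 'X_j : S).
Proof.
move=> hg hg'; apply: bihomogB; apply: (@bihomogM _ _ _ 2 0 0 1);
  by [apply: bihomog_h | apply: bihomog_y].
Qed.

Lemma igen0_reg (f h : S) : h <> 0 -> igen [::] (f * h) -> igen [::] f.
Proof. by move=> h0 fh; apply: bipoly_integral fh h0. Qed.

Lemma subst_coef u (c : R) : (forall k, u (inl k) = var K (inl k)) ->
  subst u (c%:MP : S) = c%:MP.
Proof.
move=> uE; rewrite -{2}(subst_id c%:MP) {1}/subst mmapC {1}/subst mmapC.
by apply: eq_bigr => m _; congr (_ * _); apply: mmap1_eq => k; rewrite uE.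
Qed.

Lemma kill_coef Z (c : R) : (forall k, inl k \notin Z) ->
  kill Z (c%:MP : S) = c%:MP.
Proof. by move=> hZ; apply: subst_coef => k; rewrite (negPf (hZ k)). Qed.

Lemma kill_y Z j : kill Z ('X_j : S) = if inr j \in Z then 0 else 'X_j.
Proof. exact: (@kill_var K n 3 Z (inr j)). Qed.

Lemma killD Z (f g : S) : kill Z (f + g) = kill Z f + kill Z g.
Proof. exact: rmorphD. Qed.

Lemma killM Z (f g : S) : kill Z (f * g) = kill Z f * kill Z g.
Proof. exact: rmorphM. Qed.

Lemma killB Z (f g : S) : kill Z (f - g) = kill Z f - kill Z g.
Proof. exact: rmorphB. Qed.

Lemma kill_minor Z g g' i j : (forall k, inl k \notin Z) ->
  kill Z (g%:MP * 'X_i - g'%:MP * 'X_j : S) =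
    g%:MP * (if inr i \in Z then 0 else 'X_i)
    - g'%:MP * (if inr j \in Z then 0 else 'X_j).
Proof.
move=> hZ; rewrite killB (killM _ g%:MP) (killM _ g'%:MP).
by rewrite (kill_coef g hZ) (kill_coef g' hZ) !kill_y.
Qed.

Lemma h1y_neq0 j : h1 * 'X_j <> 0.
Proof. by move/bipoly_integral => /(_ (@y_neq0 j)) /h1_neq0. Qed.

Lemma minor_neq0 g j : j != i1 -> h1 * 'X_j - g%:MP * y1 <> 0.
Proof.
move=> j1 /(congr1 (kill [:: v1])); rewrite kill_minor // (rmorph0 (kill _)).
rewrite !inE /v1 eqxx mulr0 subr0 ifN; first exact: h1y_neq0.
by apply: contra j1 => /eqP[->].
Qed.

Lemma reg_h2_h1 f : igen [:: h1] (f * h2) -> igen [:: h1] f.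
Proof. exact: (igen_coef_reg (s := [:: g1])). Qed.

Lemma reg_h3_h12 f : igen [:: h2; h1] (f * h3) -> igen [:: h2; h1] f.
Proof. exact: (igen_coef_reg (s := [:: g2; g1])). Qed.

Lemma reg_m23_h1 f : igen [:: h1] (f * m23) -> igen [:: h1] f.
Proof. exact: (igen_linear_reg (s := [:: g1])). Qed.

Lemma reg_vars (Z : seq ('I_n + 'I_3)) (f h : S) : kill Z h <> 0 ->
  igen (map (@var K n 3) Z) (f * h) -> igen (map (@var K n 3) Z) f.
Proof. exact: igen_vars_reg. Qed.

Lemma reg_y_h1 j f : igen [:: h1] (f * 'X_j) -> igen [:: h1] f.
Proof.
apply: igen_swap => f' h.
  apply: (reg_vars (Z := [:: inr j])) h; rewrite kill_coef //.
  exact: h1_neq0.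
by apply: igen0_reg h; apply: y_neq0.
Qed.

Lemma reg_m12_y3 f : igen [:: y3] (f * m12) -> igen [:: y3] f.
Proof.
apply: (reg_vars (Z := [:: v3])); rewrite kill_minor //.
exact: (minor_neq0 (j := i2)).
Qed.

Lemma reg_h1_y1 f : igen [:: y1] (f * h1) -> igen [:: y1] f.
Proof.
by apply: (reg_vars (Z := [:: v1])); rewrite kill_coef //; apply: h1_neq0.
Qed.

Lemma reg_y3_m12 f : igen [:: m12] (f * y3) -> igen [:: m12] f.
Proof.
apply: igen_swap => f' h; first exact: reg_m12_y3.
by apply: igen0_reg h; apply: y_neq0.
Qed.

Lemma reg_y1_m12y3 f : igen [:: m12; y3] (f * y1) -> igen [:: m12; y3] f.
Proof.
apply: igen_swap => f'.
  apply: (reg_vars (Z := [:: v1; v3])); rewrite kill_minor //= mulr0 subr0.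
  exact: h1y_neq0.
apply: (reg_vars (Z := [:: v3])); rewrite kill_y; exact: y_neq0.
Qed.

Lemma reg_y2_h1y1 f : igen [:: h1; y1] (f * y2) -> igen [:: h1; y1] f.
Proof.
apply: igen_swap => f'.
  by apply: (reg_vars (Z := [:: v2; v1])); rewrite kill_coef //; apply: h1_neq0.
apply: (reg_vars (Z := [:: v1])); rewrite kill_y; exact: y_neq0.
Qed.

Lemma reg_y3_h1y21 f : igen [:: h1; y2; y1] (f * y3) -> igen [:: h1; y2; y1] f.
Proof.
apply: igen_swap => f'.
  by apply: (reg_vars (Z := [:: v3; v2; v1])); rewrite kill_coef //;
    apply: h1_neq0.
apply: (reg_vars (Z := [:: v2; v1])); rewrite kill_y; exact: y_neq0.
Qed.

(** Modulo [h1], [m12] is - [h2 * y1], a product of two regular elements; the exchange then makes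
    [h1] regular modulo [m12]. *)
Lemma reg_h1_m12 f : igen [:: m12] (f * h1) -> igen [:: m12] f.
Proof.
apply: igen_swap => f' H; last by apply: igen0_reg H; apply: h1_neq0.
apply: (@reg_y_h1 i1); apply: reg_h2_h1.
have -> : f' * 'X_i1 * h2 = f' * y2 * h1 - f' * m12 by rewrite /m12 /y1; ring.
by apply: (idealB (igen_ideal _)); [apply: igen_head | apply: H].
Qed.

Lemma subst_scale c a b (f : S) : bihomog a b f ->
  subst (fun v => match v with inl k => var K (inl k) | inr j => c * 'X_j end) f
    = c ^+ b * f.
Proof.
case=> fb _; rewrite {2}[f]mpolyE {1}[f]mpolyE mulr_sumr rmorph_sum /=.
rewrite big_seq [RHS]big_seq; apply: eq_bigr => m fm.
rewrite -!mul_mpolyC (rmorphM (subst _)) /= subst_coef // mulrCA; congr (_ * _).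
rewrite mpolyXE_id (rmorph_prod (subst _)) /=.
under eq_bigr => j _.
  rewrite (rmorphXn (subst _)) /= (@subst_var K n 3 _ (inr j)) exprMn.
  over.
rewrite big_split /=; congr (_ * _).
by rewrite -expr_sum -mdegE (dhomog_mf fb fm).
Qed.

(* A form in the kernel of the specialization y_j -> g_j y_1 is killed by a
   power of g_1 modulo the minors. *)
Lemma subst_minors (N : S -> Prop) (d : 'I_3 -> S) a b f :
  is_ideal N -> (forall j, N (h1 * 'X_j - d j)) -> bihomog a b f ->
  subst (fun v => match v with inl k => var K (inl k) | inr j => d j end)
    f = 0 ->
  N (h1 ^+ b * f).
Proof.
move=> idN Nd fab fd; rewrite -(subst_scale h1 fab) -[subst _ f]subr0 -{1}fd.
by apply: subst_congr => // -[k|j]; [rewrite subrr; apply: ideal0 | apply: Nd].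
Qed.

Lemma reg_m13_m12 a b f : bihomog a b f ->
  igen [:: m12] (f * m13) -> igen [:: m12] f.
Proof.
move=> fab fm.
(* This solves m12 = 0 after inverting g_1: the differences h1 y_j - d_j are 0, [m12], 0. The
   specialization turns [m13] into [m13 * h1], nonzero in a domain, so it must kill [f]. *)
pose d (j : 'I_3) := nth 0 [:: h1 * y1; h2 * y1; h1 * y3] j.
pose u (v : 'I_n + 'I_3) : S :=
  match v with inl k => var K (inl k) | inr j => d j end.
have uh (g : R) : subst u (g%:MP : S) = g%:MP by apply: subst_coef.
have uy j : subst u ('X_j : S) = d j by apply: (@subst_var K n 3 u (inr j)).
have minor g g' i j : subst u (g%:MP * 'X_i - g'%:MP * 'X_j : S)
    = g%:MP * d i - g'%:MP * d j.
  by rewrite (rmorphB (subst u)) !(rmorphM (subst u)) /= !uh !uy.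
have fu : subst u f = 0.
  have H : subst u (f * m13) = 0.
    have [c ->] := (igen1P m12 _).1 fm.
    by rewrite (rmorphM (subst u)) /= minor /d /=; ring.
  move: H; rewrite (rmorphM (subst u)) => /bipoly_integral; apply.
  rewrite /= minor /d /=; have -> : h1 * (h1 * y3) - h3 * (h1 * y1) = m13 * h1.
    by rewrite /m13; ring.
  by move/bipoly_integral => /(_ h1_neq0); apply: (minor_neq0 (j := i3)).
have : igen [:: m12] (h1 ^+ b * f).
  apply: (subst_minors (d := d)) fab fu; first exact: igen_ideal.
  apply: ord3P; rewrite /d /=.
  - by rewrite subrr; apply: ideal0.
  - exact: igen_self.
  - by rewrite subrr; apply: ideal0.
elim: b {fab} => [|b IH]; first by rewrite mul1r.
by rewrite exprS -mulrA mulrC => /reg_h1_m12.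
Qed.

Let t2 := [:: m13; m12].
Let t3 := [:: m23; m13; m12].

Lemma t2_sum a b : igen t2 (a * m13 + b * m12).
Proof. by apply/igen2P; exists a, b. Qed.

Lemma t3_sum c a b : igen t3 (c * m23 + a * m13 + b * m12).
Proof.
exists c; have -> : c * m23 + a * m13 + b * m12 - c * m23 = a * m13 + b * m12.
  by ring.
exact: t2_sum.
Qed.

Lemma t2_m12 : igen t2 m12.
Proof. exact/igen_cons/igen_self. Qed.

Lemma t2_m13 : igen t2 m13.
Proof. exact: igen_self. Qed.

Lemma t3_t2 f : igen t2 f -> igen t3 f.
Proof. exact: igen_cons. Qed.

(** Expansion of the vanishing determinant in which one row of the matrix with rows (h1, h2, h3) and
    (y1, y2, y3) is repeated: here the second row, in [m23_h1] the first. *)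
Lemma m23_y1 f : f * y1 * m23 = f * y2 * m13 + (- f * y3) * m12.
Proof. by rewrite /m23 /m13 /m12; ring. Qed.

Lemma m23_h1 f : f * h1 * m23 = f * h2 * m13 + (- f * h3) * m12.
Proof. by rewrite /m23 /m13 /m12; ring. Qed.

Lemma kill_igen (Z : seq ('I_n + 'I_3)) (f : S) :
  kill Z f = 0 -> igen (map (@var K n 3) Z) f.
Proof. by move=> /igen_varsP. Qed.

Lemma kill1_m12 : kill [:: v1] m12 = h1 * y2.
Proof. by rewrite kill_minor //= mulr0 subr0. Qed.

Lemma kill1_m13 : kill [:: v1] m13 = h1 * y3.
Proof. by rewrite kill_minor //= mulr0 subr0. Qed.

Lemma kill1_y1 f : kill [:: v1] (f * y1) = 0.
Proof. by rewrite killM kill_y mulr0. Qed.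

Lemma kill1_m23 : kill [:: v1] m23 = m23.
Proof. by rewrite kill_minor. Qed.

Lemma kill1_t2 a b : kill [:: v1] (a * m13 + b * m12)
  = kill [:: v1] a * (h1 * y3) + kill [:: v1] b * (h1 * y2).
Proof. have H (p q : S) : kill [:: v1] (a * p + b * q)
    = kill [:: v1] a * kill [:: v1] p + kill [:: v1] b * kill [:: v1] q.
  by rewrite killD !killM.
exact: etrans (H m13 m12)
  (congr2 (fun p q => _ * p + _ * q) kill1_m13 kill1_m12).
Qed.

(** One inclusion is given by the two determinantal syzygies. For the other, setting y_1 = 0 turns
    [m12] and [m13] into multiples of [h1] and leaves [m23] unchanged, which is regular modulo
    [h1]. *)
Lemma t2_m23P f : igen [:: h1; y1] f <-> igen t2 (f * m23).
Proof.
split=> [/igen2P[c [d ->]]|].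
  by rewrite mulrDl m23_h1 m23_y1; apply: idealD => //; apply: t2_sum.
case/igen2P=> a [b E].
have := congr1 (kill [:: v1]) E.
rewrite kill1_t2 killM kill1_m23; set f0 := kill _ f.
move: (kill _ a) (kill _ b) => a0 b0 E0.
have [|c f0E] := (igen1P h1 f0).1.
  apply: reg_m23_h1; rewrite E0; apply/igen1P; exists (a0 * y3 + b0 * y2).
  by ring.
exists c; rewrite -f0E; exact: (igen_kill [:: v1]).
Qed.

(** If f y_1 = a m13 + b m12, setting y_1 = 0 gives a y_3 + b y_2 = 0, whence a = e y_2 and b = - e
    y_3 up to multiples of y_1. The syzygy y_2 m13 - y_3 m12 = y_1 m23 then lets y_1 be
    cancelled. *)
Lemma t2_y1P f : igen t3 f <-> igen t2 (f * y1).
Proof.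
split=> [[c /igen2P[a [b E]]]|].
  have -> : f * y1 = (a * y1 + c * y2) * m13 + (b * y1 - c * y3) * m12.
    by rewrite -[f](subrK (c * m23)) E /m23 /m13 /m12; ring.
  exact: t2_sum.
case/igen2P=> a [b E].
have := congr1 (kill [:: v1]) E.
rewrite kill1_t2 kill1_y1.
have [a' a'E] := (igen1P y1 _).1 (igen_kill [:: v1] a).
have [b' b'E] := (igen1P y1 _).1 (igen_kill [:: v1] b).
move: (kill _ a) (kill _ b) a'E b'E => a0 b0 a'E b'E E0.
have {}E0 : a0 * y3 + b0 * y2 = 0.
  have : (a0 * y3 + b0 * y2) * h1 = 0 by rewrite E0; ring.
  by move/bipoly_integral; apply; apply: h1_neq0.
have [|e a0E] := (igen1P y2 a0).1.
  apply: (reg_vars (Z := [:: v2]) (h := y3)); first by rewrite kill_y;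
    apply: y_neq0.
  apply/(igen1P y2); exists (- b0); rewrite mulNr; apply/eqP.
  by rewrite -subr_eq0 opprK E0.
have b0E : b0 = - e * y3.
  apply/eqP; rewrite -subr_eq0; apply/eqP.
  apply: (@bipoly_integral _ _ _ _ y2); last exact: y_neq0.
  by rewrite -E0 a0E; ring.
have -> : f = e * m23 + a' * m13 + b' * m12; last exact: t3_sum.
apply/eqP; rewrite -subr_eq0; apply/eqP.
apply: (@bipoly_integral _ _ _ _ y1); last exact: y_neq0.
rewrite mulrBl E -(subrK a0 a) -(subrK b0 b) a'E b'E a0E b0E /m23 /m13 /m12.
by ring.
Qed.

(** Setting y_1 = 0 in f y_1 = e m23 modulo J2 puts e m23 in (h1, y1), so e lies in (h1, y1) = (J2 :
    m23). Hence f y_1 is already in J2, and (J2 : y_1) = J3. *)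
Lemma reg_y1_t3 f : igen t3 (f * y1) -> igen t3 f.
Proof.
case=> e /igen2P[a [b E]].
have {}E : f * y1 = e * m23 + (a * m13 + b * m12).
  by apply/eqP; rewrite [X in _ == X]addrC -subr_eq; apply/eqP.
have := congr1 (kill [:: v1]) E.
rewrite kill1_y1 killD kill1_t2 killM kill1_m23.
move: (kill _ a) (kill _ b) => a0 b0 E0.
have [|c eE] := (igen1P h1 (kill [:: v1] e)).1.
  apply: reg_m23_h1; apply/igen1P; exists (- (a0 * y3 + b0 * y2)).
  apply/eqP; rewrite -subr_eq0; apply/eqP; rewrite E0; ring.
have /t2_m23P em : igen [:: h1; y1] e.
  by exists c; rewrite -eE; apply: (igen_kill [:: v1]).
by apply/t2_y1P; rewrite E; apply: idealD => //; apply: t2_sum.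
Qed.

(** The full regular sequence enters here. From f h1 = a m13 + b m12 follows that a h3 + b h2 is a
    multiple of h1; regularity of g_3, then of g_2, gives a = e h2 and b = - e h3 up to multiples of
    h1, and h2 m13 - h3 m12 = h1 m23. *)
Lemma t2_h1 f : igen t2 (f * h1) -> igen t3 f.
Proof.
case/igen2P=> a [b E].
have [c cE] : exists c, a * h3 + b * h2 = c * h1.
  apply/igen1P/(@reg_y_h1 i1)/igen1P; exists (a * y3 + b * y2 - f).
  by rewrite mulrBl E /m13 /m12 /y1; ring.
have /igen2P[e [a' aE]] : igen [:: h2; h1] a.
  by apply: reg_h3_h12; apply/igen2P; exists (- b), c; rewrite -cE; ring.
have /igen1P[b' bE] : igen [:: h1] (b + e * h3).
  apply: reg_h2_h1; apply/igen1P; exists (c - a' * h3).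
  by rewrite mulrBl -cE aE; ring.
have -> : f = e * m23 + a' * m13 + b' * m12; last exact: t3_sum.
apply/eqP; rewrite -subr_eq0; apply/eqP.
apply: (@bipoly_integral _ _ _ _ h1); last exact: h1_neq0.
by rewrite mulrBl E aE -[b](addrK (e * h3)) bE /m23 /m13 /m12; ring.
Qed.

(** A factor y_1 brings the hypothesis from J3 down to J2, where [t2_h1] controls [h1]; it is then
    cancelled modulo J3. *)
Lemma reg_h1_t3 f : igen t3 (f * h1) -> igen t3 f.
Proof.
move=> fh; apply: reg_y1_t3; apply: t2_h1.
by rewrite mulrAC; apply/t2_y1P.
Qed.

Definition point (j : 'I_3) : R := nth 0 [:: g1; g2; g3] j.

(** As [f] has degree b in the y's, sending y_j to g_j y_1 gives f(g) y_1^b = 0. The differences h1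
    y_j - g_j y_1 are 0, [m12], [m13], so [subst_minors] applies, and [reg_h1_t3] removes the power
    of g_1. *)
Lemma t3_ker a b f : bihomog a b f -> f.@[point] = 0 -> igen t3 f.
Proof.
move=> fab f0; have fb : f \is b.-homog by case: fab.
have : igen t3 (h1 ^+ b * f).
  apply: (subst_minors (d := fun j => (point j)%:MP * y1)) fab _.
  - exact: igen_ideal.
  - apply: ord3P; rewrite /point /=.
    + by rewrite subrr; apply: ideal0.
    + exact/t3_t2/t2_m12.
    + exact/t3_t2/t2_m13.
  - set u := (X in subst X f).
  have -> : subst u f = (f.@[point])%:MP * y1 ^+ b.
    rewrite {1}[f]mpolyE mevalE rmorph_sum (rmorph_sum (@mpolyC 3 R)) /=.
    rewrite mulr_suml big_seq [RHS]big_seq; apply: eq_bigr => m fm.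
    rewrite -!mul_mpolyC (rmorphM (subst u)) /= subst_coef // mpolyCM -mulrA.
    congr (_ * _); rewrite mpolyXE_id (rmorph_prod (subst u))
      (rmorph_prod (@mpolyC 3 R)) /=.
    under eq_bigr => j _.
      rewrite (rmorphXn (subst u)) /=
        (@subst_var K n 3 u (inr j)) exprMn -rmorphXn.
      over.
    rewrite big_split /=; congr (_ * _).
    by rewrite -expr_sum -mdegE (dhomog_mf fb fm).
  by rewrite f0 mpolyC0 mul0r.
elim: b {fab fb} => [|b IH]; first by rewrite mul1r.
by rewrite exprS -mulrA mulrC => /reg_h1_t3.
Qed.

Lemma t3_meval f : igen t3 f -> f.@[point] = 0.
Proof.
have E (c : S) g g' i j : g * point i - g' * point j = 0 ->
    (c * (g%:MP * 'X_i - g'%:MP * 'X_j)).@[point] = 0.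
  by move=> e; rewrite mevalM mevalB !mevalM !mevalC !mevalXU e mulr0.
have P (p q : S) : p.@[point] = 0 -> q.@[point] = 0 -> (p + q).@[point] = 0.
  by rewrite mevalD => -> ->; rewrite addr0.
case=> c /igen2P[a [b Ef]]; rewrite -[f](subrK (c * m23)) Ef.
apply: (P); first apply: (P).
- by apply: E; rewrite /point /= mulrC subrr.
- by apply: E; rewrite /point /= mulrC subrr.
- by apply: E; rewrite /point /= mulrC subrr.
Qed.

(* In bidegree (i, i) a multiple of g_1 is a multiple of the g_1 y_j. *)
Lemma igen_h1_diag t (N : S -> Prop) i f : bihomogs t -> is_ideal N ->
  (forall g, igen t g -> N g) -> (forall j, N (h1 * 'X_j)) ->
  bihomog i i f -> igen (h1 :: t) f -> N f.
Proof.
move=> ht idN tN Nh fi ft; case: i fi => [|[|i]] fi.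
- by apply/tN/(igen_bihomog_low ht (bihomog_h g1h) fi).
- by apply/tN/(igen_bihomog_low ht (bihomog_h g1h) fi).
have fi' : bihomog (i + 2) (i.+2 + 0) f by rewrite addn2 addn0.
have [c ci tc] := igen_bihomog ht (bihomog_h g1h) fi' ft.
rewrite -(subrK (c * h1) f); apply: idealD => //; first exact: tN.
have cy : igen (map (@var K n 3) (map inr (enum 'I_3))) c.
  apply: (igen_side (s := false) (a := i) (b := i.+1)).
    by case=> // j _; apply/map_f; rewrite mem_enum.
  by rewrite addn0 addn1.
have idN' : is_ideal (fun c => N (c * h1)).
  split=> [|x y z]; first by rewrite mul0r; apply: ideal0.
  by rewrite mulrDl -mulrA; case: idN => _; apply.
apply: (igen_min idN' _ cy) => h /mapP[_ /mapP[j _ ->] ->] /=.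
by rewrite mulrC; apply: Nh.
Qed.

(** * Linearity over the diagonals of S/J0, S/J1, S/J2 and S/J3 *)

Let vr := @var K n 3.
Let xs : seq S := map vr (alive true ([::] : seq ('I_n + 'I_3))).
Local Notation J0 := (@igen {mpoly {mpoly K[n]}[3]} [::]).
Local Notation J1 := (igen [:: m12]).
Local Notation J2 := (igen t2).
Local Notation J3 := (igen t3).

Lemma bihomogs_nil : bihomogs ([::] : seq S).
Proof. by []. Qed.

Lemma bihomog_m12 : bihomog 2 1 m12. Proof. exact: bihomog_minor. Qed.
Lemma bihomog_m13 : bihomog 2 1 m13. Proof. exact: bihomog_minor. Qed.
Lemma bihomog_m23 : bihomog 2 1 m23. Proof. exact: bihomog_minor. Qed.

Lemma bihomogs_t1 : bihomogs [:: m12].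
Proof. exact: bihomogs_cons bihomog_m12 bihomogs_nil. Qed.

Lemma bihomogs_t2 : bihomogs t2.
Proof. exact: bihomogs_cons bihomog_m13 bihomogs_t1. Qed.

Lemma spans_x N : is_ideal N -> spans N 1 0 xs.
Proof.
move=> idN; apply: spans_le (@spans_alive K n 3 true [::]) => f ->.
exact: ideal0.
Qed.

Lemma spans_y (N : S -> Prop) Z (a : seq ('I_n + 'I_3)) : is_ideal N ->
  (forall v, v \in a -> isx v = false) ->
  (forall v, isx v = false -> v \in a ++ Z) ->
  (forall v, v \in Z -> N (vr v)) -> spans N 0 1 (map vr a).
Proof.
move=> idN ay aZ ZN; apply: spans_le (@spans_vars K n 3 Z false a ay aZ).
by apply: igen_min => // h /mapP[v vZ ->]; apply: ZN.
Qed.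

Lemma J0_sub (N : S -> Prop) : is_ideal N -> forall f, J0 f -> N f.
Proof. by move=> idN f ->; apply: ideal0. Qed.

Lemma segre_cyclic Z p : linear_upto J0 p (igen (map vr Z)) [:: 1].
Proof. by have [] := @segre_linear K n 3 p. Qed.

Lemma segre_xs Z p : (forall k, inl k \notin Z) ->
  linear_upto J0 p (igen (map vr Z)) xs.
Proof.
move=> hZ; have [_] := @segre_linear K n 3 p; apply.
  by rewrite filter_uniq // enum_uniq.
by move=> v; rewrite mem_alive; case: v => [k|j]; rewrite ?hZ.
Qed.

Lemma segre_y Z a p : uniq a ->
  (forall v, (v \in a) = (isx v == false) && (v \notin Z)) ->
  linear_upto J0 p (igen (map vr Z)) (map vr a).
Proof. by move=> ua aE; have [_] := @segre_linear K n 3 p; apply. Qed.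

Lemma mem_ys (v : 'I_n + 'I_3) : (v \in [:: v3; v1; v2]) = ~~ isx v.
Proof. by case: v => [k|[[|[|[|//]]] lj]]. Qed.

Lemma regP (N : S -> Prop) h f : is_ideal N ->
  (N (f * h) -> N f) -> N f <-> N (f * h).
Proof. by move=> idN reg; split=> // Nf; rewrite mulrC; apply: idealM. Qed.

Lemma igenC (a b : S) t f : igen [:: a, b & t] f -> igen [:: b, a & t] f.
Proof. by case=> c [d H]; exists d, c; rewrite addrAC. Qed.

Lemma igen_consl (a : S) t t' f : (forall g, igen t g -> igen t' g) ->
  igen (a :: t) f -> igen (a :: t') f.
Proof. by move=> tt' [c H]; exists c; apply: tt'. Qed.

Lemma bihomog_h1 : bihomog 2 0 h1. Proof. exact: bihomog_h. Qed.

Lemma free_minors (t : seq S) : (forall p : S, p \in t -> bihomog 2 1 p) ->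
  forall c : S, bihomog 0 0 c -> igen t c -> c = 0.
Proof.
elim: t => [|p t IH] ht c hc; first by [].
have ht' q : q \in t -> bihomog 2 1 q by move=> qt; apply: ht;
  rewrite inE qt orbT.
move=> tc; apply: (IH ht' c hc).
have bt : bihomogs t by move=> q /ht'; exists 2, 1.
exact: igen_bihomog_low bt (ht _ (mem_head _ _)) hc _ tc.
Qed.

Lemma free_J1 p : linear_upto J1 p J1 [:: 1].
Proof.
apply: linear_upto_free; apply: free_minors => q; rewrite inE => /eqP->.
exact: bihomog_m12.
Qed.

Lemma free_J2 p : linear_upto J2 p J2 [:: 1].
Proof.
apply: linear_upto_free; apply: free_minors => q.
by rewrite !inE => /orP[] /eqP->; [apply: bihomog_m13 | apply: bihomog_m12].
Qed.

(** Since (2, 1) = (1, 0) + (1, 1), [m12] is a single linear relation in the twist generated by the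
    x's, and its multiples form a copy of S. *)
Lemma base_m12 p : linear_upto J0 p J1 xs.
Proof.
case: p => // p.
apply: (linear_quotient (N1 := J0) (a := 1) (b := 0) (a1 := 0) (b1 := 0)
  (s1 := [:: 1]) _ _ _ bihomogs_nil bihomog_m12) => //.
- exact: spans_x.
- exact: spans1.
- move=> i f _; apply: regP => //; apply: igen0_reg.
  exact: (minor_neq0 (j := i2)).
- exact: (@segre_xs [::]).
- exact: (segre_cyclic [::]).
Qed.

Lemma bihomogs1 a b (h : S) : bihomog a b h -> bihomogs [:: h].
Proof. by move=> hh; apply: bihomogs_cons hh bihomogs_nil. Qed.

Lemma base_m12_y3 p : linear_upto J0 p (igen [:: m12; y3]) xs.
Proof.
case: p => // p.
apply: (linear_quotient (N1 := igen [:: y3]) (a := 1) (b := 0) (a1 := 0)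
  (b1 := 0) (s1 := [:: 1]) _ _ _ (bihomogs1 (bihomog_y i3)) bihomog_m12) => //.
- exact: J0_sub.
- exact: spans_x.
- exact: spans1.
- by move=> i f _; apply: regP => //; apply: reg_m12_y3.
- exact: (@segre_xs [:: v3]).
- exact: (segre_cyclic [:: v3]).
Qed.

Lemma mem_y23 (v : 'I_n + 'I_3) :
  (v \in [:: v2; v3]) = (isx v == false) && (v \notin [:: v1]).
Proof. by case: v => [k|[[|[|[|//]]] lj]]. Qed.

Lemma spans_y23 (N : S -> Prop) : is_ideal N -> N y1 -> spans N 0 1 [:: y2; y3].
Proof.
move=> idN Ny1; apply: (spans_y (Z := [:: v1]) (a := [:: v2; v3])) => // v.
- by rewrite mem_y23 => /andP[/eqP].
- by rewrite mem_cat mem_y23 => ->; case: (v \in _).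
- by rewrite inE => /eqP->.
Qed.

(** Here (2, 0) + (0, 1) = (1, 0) + (1, 1): [h1] needs a factor y_j to become a linear relation
    between the x's, and modulo [y1] the factors y_2 and y_3 remain. *)
Lemma base_h1_y1 p : linear_upto J0 p (igen [:: h1; y1]) xs.
Proof.
case: p => // p.
apply: (linear_quotient (N1 := igen [:: y1]) (a := 1) (b := 0) (a1 := 0)
  (b1 := 1) (s1 := [:: y2; y3]) _ _ _ (bihomogs1 (bihomog_y i1)) bihomog_h1)
    => //.
- exact: J0_sub.
- exact: spans_x.
- by apply: spans_y23 => //; apply: igen_self.
- by move=> i f _; apply: regP => //; apply: reg_h1_y1.
- exact: (@segre_xs [:: v1]).
- exact: (@segre_y [:: v1] [:: v2; v3] _ _ mem_y23).
Qed.

Lemma spans_y312 (N : S -> Prop) : is_ideal N -> spans N 0 1 [:: y3; y1; y2].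
Proof.
move=> idN; apply: (spans_y (Z := [::]) (a := [:: v3; v1; v2])) => // v.
  by rewrite mem_ys => /negbTE.
by rewrite mem_cat mem_ys => ->.
Qed.

Lemma change1 p N s : is_ideal N -> (forall f, J1 f -> N f) ->
  linear_upto J0 p N s -> linear_upto J1 p N s.
Proof.
apply: (linear_change (N1 := J0) (s1 := [:: y3; y1; y2]) bihomogs_nil
  bihomog_m12) => //.
- exact: spans_y312.
- move=> i f _; apply: regP => //; apply: igen0_reg.
  exact: (minor_neq0 (j := i2)).
- move=> q; apply: (@segre_y [::] [:: v3; v1; v2]) => // v.
  by rewrite mem_ys; case: v.
Qed.

Lemma m12_y3_m12 f : J1 f -> igen [:: m12; y3] f.
Proof. by move=> /igen1P[c ->]; apply: igen_head. Qed.

Lemma lin1_y3 p : linear_upto J1 p (igen [:: y3; m12]) [:: 1].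
Proof.
case: p => // p.
apply: (linear_quotient (N1 := J1) (a := 0) (b := 0) (a1 := 1)
  (b1 := 0) (s1 := xs) _ _ _ bihomogs_t1 (bihomog_y i3)) => //.
- exact: spans1.
- exact: spans_x.
- by move=> i f _; apply: regP => //; apply: reg_y3_m12.
- exact: free_J1.
- by apply: change1 (base_m12 p).
Qed.

Lemma lin1_y13 p : linear_upto J1 p (igen [:: y1; m12; y3]) [:: 1].
Proof.
case: p => // p.
apply: (linear_quotient (N1 := igen [:: m12; y3]) (a := 0) (b := 0) (a1 := 1)
  (b1 := 0) (s1 := xs) _ _ _ _ (bihomog_y i1)) => //.
- exact: m12_y3_m12.
- exact: bihomogs_cons bihomog_m12 (bihomogs1 (bihomog_y i3)).
- exact: spans1.
- exact: spans_x.
- by move=> i f _; apply: regP => //; apply: reg_y1_m12y3.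
- by apply: linear_upto_eq (lin1_y3 _) => f; split=> /igenC.
- by apply: change1 (base_m12_y3 p) => //; apply: m12_y3_m12.
Qed.

Lemma comb_single (h : S) (v : 'rV_(size [:: h])) : comb v = v 0 0 * h.
Proof. by rewrite /comb mxE big_ord1 mxE. Qed.

Lemma linear_upto_single J p N (h : S) :
  (forall i f, bihomog i i f -> N f <-> N (f * h)) ->
  linear_upto J p N [:: 1] -> linear_upto J p N [:: h].
Proof.
move=> NP; apply: lin_ext => i v vi.
rewrite /relations comb1 comb_single; apply: (NP i); exact: vi.
Qed.

(** The ideal is (y1, y3, h1 y2), modulo which y_2 is a zero divisor: its colon ideal is (h1, y1,
    y3). In bidegrees (i, i) this is no larger, since every h1 y_j already lies in the ideal. *)
Lemma lin1_y13_y2 p : linear_upto J1 p (igen [:: y1; m12; y3]) [:: y2].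
Proof.
apply: linear_upto_single (lin1_y13 p) => i f fi; apply: regP => //.
set N := igen _.
have idN : is_ideal N by exact: igen_ideal.
have Ny1 c : N (c * y1) by apply: igen_head.
have Ny3 c : N (c * y3).
  by apply: igen_cons; apply: igen_cons; apply: igen_head.
have Nh2 : N (h1 * y2).
  have -> : h1 * y2 = m12 + h2 * y1 by rewrite /m12; ring.
  by apply: (idealD idN); [apply/igen_cons/igen_self | apply: Ny1].
have N13 g : igen [:: y1; y3] g -> N g.
  by case/igen2P=> a [b ->]; apply: (idealD idN); [apply: Ny1 | apply: Ny3].
move=> Nf; apply: (igen_h1_diag _ idN N13 _ fi).
- exact: bihomogs_cons (bihomog_y i1) (bihomogs1 (bihomog_y i3)).
- by apply: ord3P; [apply: Ny1 | apply: Nh2 | apply: Ny3].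
case: Nf => a [b [c /eqP]]; rewrite subr_eq0 => /eqP E.
have [d [e dE]] : exists d e, f - b * h1 = d * y1 + e * y3.
  apply/igen2P; apply: (reg_vars (Z := [:: v1; v3]) (h := y2)).
    by rewrite kill_y; apply: y_neq0.
  apply/(igen2P y1 y3); exists (a - b * h2), c.
  rewrite -E /m12; ring.
by exists b; apply/igen2P; exists d, e.
Qed.

Lemma lin1_y3_y12 p : linear_upto J1 p (igen [:: y3; m12]) [:: y1; y2].
Proof.
apply: (linear_extension (N1 := igen [:: y3; m12]) _ _ _ _ (bihomog_y i1))
  => //.
- exact: igen_cons.
- exact: bihomogs_cons (bihomog_y i3) bihomogs_t1.
- by move=> g; rewrite inE => /eqP->; apply: bihomog_y.
- move=> i f _; apply: regP => // /igenC H.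
  by apply/igenC/reg_y1_m12y3.
- exact: lin1_y3.
- apply: linear_upto_eq (lin1_y13_y2 p) => f.
  by split; apply: igen_consl => g; apply: igenC.
Qed.

(** This is the condition for adjoining [m13], which is regular modulo J1 on forms. In this order
    y_3 and y_1 are regular in turn, and only y_2 relies on the diagonal. *)
Lemma lin1_y312 p : linear_upto J1 p J1 [:: y3; y1; y2].
Proof.
apply: (linear_extension (N1 := J1) _ _ _ bihomogs_t1 (bihomog_y i3)) => //.
- by move=> g; rewrite !inE => /orP[] /eqP->; apply: bihomog_y.
- by move=> i f _; apply: regP => //; apply: reg_y3_m12.
- exact: free_J1.
- exact: lin1_y3_y12.
Qed.

Lemma change2 p N s : is_ideal N -> (forall f, J2 f -> N f) ->
  linear_upto J1 p N s -> linear_upto J2 p N s.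
Proof.
apply: (linear_change (N1 := J1) (s1 := [:: y3; y1; y2]) bihomogs_t1
  bihomog_m13) => //.
- exact: spans_y312.
- by move=> i f fi; apply: regP => //; apply: reg_m13_m12 fi.
- exact: lin1_y312.
Qed.

Lemma lin1_t2_x p : linear_upto J1 p J2 xs.
Proof.
case: p => // p.
apply: (linear_quotient (N1 := J1) (a := 1) (b := 0) (a1 := 0) (b1 := 0)
  (s1 := [:: 1]) _ _ _ bihomogs_t1 bihomog_m13) => //.
- exact: spans_x.
- exact: spans1.
- by move=> i f fi; apply: regP => //; apply: reg_m13_m12 fi.
- exact: change1 (base_m12 _).
- exact: free_J1.
Qed.

Lemma t2_h1y1 f : J2 f -> igen [:: h1; y1] f.
Proof.
case/igen2P=> a [b ->]; apply/igen2P;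
  exists (a * y3 + b * y2), (- a * h3 - b * h2).
by rewrite /m13 /m12; ring.
Qed.

Lemma t1_h1y1 f : J1 f -> igen [:: h1; y1] f.
Proof. by move=> H; apply/t2_h1y1/igen_cons. Qed.

Lemma bihomogs_h1y1 : bihomogs [:: h1; y1].
Proof. exact: bihomogs_cons bihomog_h1 (bihomogs1 (bihomog_y i1)). Qed.

(** The ideal on the left is (y1, h1 y2, h1 y3); it contains every h1 y_j, hence every multiple of
    h1 on the diagonal. *)
Lemma y1_t2_diag i f : bihomog i i f ->
  igen [:: y1, m13 & [:: m12]] f <-> igen [:: h1; y1] f.
Proof.
move=> fi; set N := igen [:: y1, m13 & _];
  have idN : is_ideal N by exact: igen_ideal.
have Ny1 c : N (c * y1) by apply: igen_head.
split=> [[c H]|].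
  rewrite -(subrK (c * y1) f); apply: (idealD (igen_ideal _));
    first exact: t2_h1y1.
  by apply: igen_cons; apply: igen_head.
apply: (igen_h1_diag (bihomogs1 (bihomog_y i1)) idN _ _ fi).
  by move=> g /igen1P[c ->]; apply: Ny1.
apply: ord3P; first exact: Ny1.
- have -> : h1 * 'X_i2 = m12 + h2 * y1 by rewrite /m12 /y2; ring.
  by apply: (idealD idN); [apply/igen_cons/t2_m12 | apply: Ny1].
- have -> : h1 * 'X_i3 = m13 + h3 * y1 by rewrite /m13 /y3; ring.
  by apply: (idealD idN); [apply/igen_cons/t2_m13 | apply: Ny1].
Qed.

(* The two modules are first syzygies of each other, up to the module of J2. *)
Lemma lin2_pair p : linear_upto J2 p (igen [:: h1; y1]) [:: 1] /\
  linear_upto J2 p J3 xs.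
Proof.
elim: p => [|p [IH1 IHx]]; first by [].
split.
  (* Written as (y1) + J2, the ideal comes from S/J2 by killing one variable; the kernel is the
     twist of S/(J2 : y1) = S/J3 by the x's. *)
  apply: (linear_upto_ext (N := igen [:: y1, m13 & [:: m12]]) (a := 0)
    (b := 0)).
  - by move=> h; rewrite inE => /eqP->; apply: bihomog1.
  - by move=> i f; rewrite addn0; apply: y1_t2_diag.
  apply: (linear_quotient (N1 := J3) (a := 0) (b := 0) (a1 := 1)
    (b1 := 0) (s1 := xs) _ _ (fun f H => H) bihomogs_t2 (bihomog_y i1)) => //.
  - exact: spans1.
  - exact: spans_x.
  - by move=> i f _; apply: t2_y1P.
  - exact: free_J2.
(* Conversely [m23] is a single linear relation between the x's over S/J2, and its multiples form a
   copy of S/(h1, y1). *)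
apply: (linear_quotient (N1 := igen [:: h1; y1]) (a := 1) (b := 0) (a1 := 0)
  (b1 := 0) (s1 := [:: 1]) _ _ (fun f H => H) bihomogs_t2 bihomog_m23) => //.
- exact: spans_x.
- exact: spans1.
- by move=> i f _; apply: t2_m23P.
- exact: change2 (lin1_t2_x _).
Qed.

Lemma lin2_y2 p : linear_upto J2 p (igen [:: y2; h1; y1]) [:: 1].
Proof.
case: p => // p.
apply: (linear_quotient (N1 := igen [:: h1; y1]) (a := 0) (b := 0) (a1 := 1)
  (b1 := 0) (s1 := xs) _ _ t2_h1y1 bihomogs_h1y1 (bihomog_y i2)) => //.
- exact: spans1.
- exact: spans_x.
- by move=> i f _; apply: regP => //; apply: reg_y2_h1y1.
- by have [] := lin2_pair p.+1.
- apply: change2; [exact: igen_ideal | exact: t2_h1y1 |].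
  by apply: change1 (base_h1_y1 p); [exact: igen_ideal | exact: t1_h1y1].
Qed.

(** These are the relations of the quadrics m23 y_2 and m23 y_3. As y_2 is regular modulo (h1, y1)
    and y_3 modulo (y2, h1, y1), both layers of the filtration are cyclic modules already
    treated. *)
Lemma lin2_y23 p : linear_upto J2 p (igen [:: h1; y1]) [:: y2; y3].
Proof.
apply: (linear_extension (N1 := igen [:: h1; y1]) _ _ t2_h1y1 bihomogs_h1y1
  (bihomog_y i2)) => //.
- by move=> g; rewrite inE => /eqP->; apply: bihomog_y.
- by move=> i f _; apply: regP => //; apply: reg_y2_h1y1.
- by have [] := lin2_pair p.
- apply: linear_upto_single (lin2_y2 p) => i f _; apply: regP => // /igenC H.
  by apply/igenC/reg_y3_h1y21.
Qed.

Lemma change3 p N s : is_ideal N -> (forall f, J3 f -> N f) ->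
  linear_upto J2 p N s -> linear_upto J3 p N s.
Proof.
apply: (linear_change (N1 := igen [:: h1; y1]) (s1 := [:: y2; y3]) bihomogs_t2
  bihomog_m23) => //.
- apply: spans_y23 => //.
  exact/igen_cons/igen_self.
- by move=> i f _; apply: t2_m23P.
- exact: lin2_y23.
Qed.

Let vars : seq ('I_n + 'I_3) := enum {: 'I_n + 'I_3}.

(** The residue field is a quotient by variables, so it is linear over the Segre product; being
    killed by all the minors, it passes through the three changes of rings. *)
Lemma residue_field_linear p : linear_upto J3 p (igen (map vr vars)) [:: 1].
Proof.
set N := igen (map vr vars); have idN : is_ideal N by exact: igen_ideal.
have NX j : N 'X_j.
  by apply: (@kill_igen vars); rewrite kill_y mem_enum.
have Nm g g' i j : N (g%:MP * 'X_i - g'%:MP * 'X_j).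
  by apply: (idealB idN); apply: (idealM idN).
have N1 f : J1 f -> N f by case/igen1P=> c ->; apply/(idealM idN)/Nm.
have N2 f : J2 f -> N f.
  by case/igen2P=> c [d ->]; apply: (idealD idN); apply/(idealM idN)/Nm.
have N3 f : J3 f -> N f.
  case=> c H; rewrite -(subrK (c * m23) f).
  by apply: (idealD idN); [apply: N2 | apply/(idealM idN)/Nm].
apply: (change3 idN N3); apply: (change2 idN N2); apply: (change1 idN N1).
exact: segre_cyclic.
Qed.

Lemma specialization_kernel : exists J : S -> Prop,
  [/\ is_ideal J, forall f, J f -> f.@[point] = 0,
      forall a b f, bihomog a b f -> f.@[point] = 0 -> J f
    & forall p, linear_upto J p (igen (map vr vars)) [:: 1]].
Proof.
exists J3; split; first exact: igen_ideal.
- exact: t3_meval.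
- exact: t3_ker.
- exact: residue_field_linear.
Qed.

End Determinantal.

(** * The algebra K[I_3] as the image of the diagonal, and its grading *)

Lemma pihomogM (K : fieldType) n d e (c g : {mpoly K[n]}) : g \is e.-homog ->
  pihomog mdeg (d + e) (c * g) = pihomog mdeg d c * g.
Proof.
move=> ge; rewrite [c](pihomog_partitionE (mf := mdeg) (leqnn _)).
rewrite mulr_suml !linear_sum /= mulr_suml; apply: eq_bigr => i _.
have ci := pihomogP mdeg i c; have cg := dhomogM ci ge.
have [<-|ne] := eqVneq (i : nat) d;
  first by rewrite (pihomog_dE cg) (pihomog_dE ci).
by rewrite (pihomog_ne0 _ cg) ?eqn_add2r // (pihomog_ne0 ne ci) mul0r.
Qed.

Lemma dhomog0C (B : nzRingType) m (p : {mpoly B[m]}) :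
  p \is 0.-homog -> p = (p@_0%MM)%:MP.
Proof.
move=> hp; apply/mpolyP=> u; rewrite mcoeffC; case: eqP => [->|/eqP u0].
  by rewrite mulr1.
rewrite mulr0; apply: (dhomog_nemf_coeff hp).
by apply: contra u0; rewrite mdeg_eq0.
Qed.

Section Specialization.
Variables (K : fieldType) (n : nat).
Local Notation R := {mpoly K[n]}.
Local Notation S := {mpoly {mpoly K[n]}[3]}.
Variables (g1 g2 g3 : R).
Hypotheses (g1h : g1 \is 2.-homog) (g2h : g2 \is 2.-homog)
    (g3h : g3 \is 2.-homog).
Local Notation pt := (point g1 g2 g3).
Local Notation A := (ideal_forms_algebra [:: g1; g2; g3] 3).
Local Notation gr := (@ideal_forms_grading K n [:: g1; g2; g3] 3).

Lemma pt_homog j : pt j \is 2.-homog.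
Proof. by case: j => -[|[|[|]]]. Qed.

Lemma ev_homog a b (f : S) : bihomog a b f -> f.@[pt] \is (a + 2 * b).-homog.
Proof.
case=> fb fa; rewrite mevalE big_seq rpred_sum // => m fm.
apply: dhomogM => //; rewrite -(dhomog_mf fb fm) /= mdegE.
elim/big_rec2: _ => [|j x y _ yx]; first by rewrite muln0 dhomog1.
rewrite mulnDr; apply: dhomogM => //.
exact: dhomogMn (pt_homog j).
Qed.

Lemma ev_diag i (f : S) : bihomog i i f -> f.@[pt] \is (3 * i).-homog.
Proof. by move/ev_homog; rewrite -mulSn. Qed.

Lemma side_span (s : bool) a b (f : S) : bihomog (a + s) (b + ~~ s) f ->
  let l := map (@var K n 3) (alive s ([::] : seq ('I_n + 'I_3))) in
  exists2 v : 'rV_(size l), entries (bihomog a b) v & f = comb v.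
Proof.
move=> fab l.
have [|||v vi fv] := @igen_cat_bihomog K n 3 l [::] a b s (~~ s) f _ _ fab.
- by [].
- by move=> h /mapP[v]; rewrite mem_alive => /andP[/eqP<- _] ->;
    apply: bihomog_var.
- rewrite cats0; apply: (igen_side _ fab) => v vs.
  by rewrite mem_alive vs eqxx.
by exists v => //; apply/eqP; rewrite -subr_eq0; apply/eqP.
Qed.

Definition diag_gens : seq S :=
  [seq ('X_p.1)%:MP * 'X_p.2 | p <- enum {: 'I_n * 'I_3}].

Lemma diag_gensP h : h \in diag_gens ->
  exists k j, h = ('X_k)%:MP * 'X_j.
Proof. by case/mapP=> -[k j] _ ->; exists k, j. Qed.

Lemma bihomog_diag_gens h : h \in diag_gens -> bihomog 1 1 h.
Proof.
case/diag_gensP=> k [j ->].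
exact: (bihomogM (@bihomog_var K n 3 (inl k)) (@bihomog_var K n 3 (inr j))).
Qed.

Lemma diag_span i (f : S) : bihomog i.+1 i.+1 f ->
  exists2 v : 'rV_(size diag_gens), entries (bihomog i i) v & f = comb v.
Proof.
move=> fi; have fi' : bihomog (i + 1) (i + 1) f by rewrite addn1.
have [|||v vi fv] := @igen_cat_bihomog K n 3 diag_gens [::] i i 1 1 f _ _ fi'.
- by [].
- exact: bihomog_diag_gens.
- rewrite cats0.
  have idG : is_ideal (igen diag_gens) by exact: igen_ideal.
  have [|v vi ->] := @side_span true i i.+1 f; first by rewrite addn0 addn1.
  rewrite /comb mxE; elim/big_ind: _ => [||k _]; first exact: ideal0.
    by move=> x y; apply: idealD.
  rewrite [X in _ * X]mxE.
  have /mapP[[x|y] xa ->] := mem_nth 0 (ltn_ord k);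
    last by rewrite mem_alive in xa.
  have [|w wi ->] := @side_span false i i (v 0 k).
    by rewrite addn0 addn1; apply: vi.
  rewrite /comb mxE mulr_suml; elim/big_ind: _ => [||j _]; first exact: ideal0.
    by move=> x' y; apply: idealD.
  rewrite [X in _ * X * _]mxE.
  have /mapP[[z|y] ya ->] := mem_nth 0 (ltn_ord j);
    first by rewrite mem_alive in ya.
  rewrite -mulrA; apply: idealM => //; apply: igen_mem; apply/mapP.
  by exists (x, y); rewrite ?mem_enum //= mulrC.
by exists v => //; apply/eqP; rewrite -subr_eq0; apply/eqP.
Qed.

Lemma ev_comb (v : 'rV_(size diag_gens)) :
  (comb v).@[pt] = \sum_k (v 0 k).@[pt] * (diag_gens`_k).@[pt].
Proof.
rewrite /comb mxE rmorph_sum /=; apply: eq_bigr => k _.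
by rewrite mxE mevalM.
Qed.

Definition diag (f : S) := forall i j, i != j -> bicomp i j f = 0.

Lemma bihomog_diag i f : bihomog i i f -> diag f.
Proof.
move=> fi a b ab; apply: (bicomp_neq fi); rewrite -negb_and.
by apply: contra ab => /andP[/eqP<- /eqP<-].
Qed.

Lemma diag_partition f : diag f ->
  exists N, forall M, (N <= M)%N -> f = \sum_(i < M) bicomp i i f.
Proof.
move=> fd; have [N fN] := bihomog_partition f; exists N => M /fN fM.
rewrite {1}fM; apply: eq_bigr => i _.
rewrite (bigD1 i) //= big1 ?addr0 // => j ji.
by apply: fd; rewrite eq_sym.
Qed.

Lemma diagM f g : diag f -> diag g -> diag (f * g).
Proof.
move=> fd gd i j ij; have [N /(_ N (leqnn N)) ->] := diag_partition gd.
rewrite mulr_sumr (raddf_sum (bicomp i j)) big1 // => k _ /=.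
rewrite (bicompM _ _ _ (bihomog_bicomp k k g)); case: ifP => // /andP[ki kj].
rewrite fd ?mul0r //; apply: contra ij => /eqP e.
by rewrite -(subnK ki) -(subnK kj) e.
Qed.

Lemma ev_sum (I : Type) (r : seq I) (P : pred I) (F : I -> S) :
  (\sum_(i <- r | P i) F i).@[pt] = \sum_(i <- r | P i) (F i).@[pt].
Proof. exact: rmorph_sum. Qed.

(** Bidegree (i, i) is sent to degree i + 2i = 3i. Distinct diagonal pieces land in distinct
    degrees, so components can be read off after specialization. *)
Lemma ev_bicomp i f : diag f ->
  pihomog mdeg (3 * i) f.@[pt] = (bicomp i i f).@[pt].
Proof.
move=> fd; have [N /(_ N (leqnn N)) fE] := diag_partition fd.
have {fE} [F Fk fE] : exists2 F : nat -> S, forall k, bihomog k k (F k)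
    & f = \sum_(k < N) F k.
  by exists (fun k => bicomp k k f) => // k; apply: bihomog_bicomp.
have -> : bicomp i i f = \sum_(k < N) bicomp i i (F k).
  by rewrite fE; apply: (raddf_sum (bicomp i i)).
rewrite fE !ev_sum linear_sum /=; apply: eq_bigr => k _.
have [<-|ne] := eqVneq (k : nat) i.
  by rewrite (bicomp_id (Fk k)) (pihomog_dE (ev_diag (Fk k))).
rewrite (pihomog_ne0 _ (ev_diag (Fk k))) ?eqn_pmul2l //.
by rewrite (bicomp_neq (Fk k)) ?ne // meval0.
Qed.

Lemma algebra_diag (a : R) :
  a \in subalg_gen (ideal_forms [:: g1; g2; g3] 3) ->
  exists2 f, diag f & a = f.@[pt].
Proof.
move/asboolP=> H.
pose T : {pred R} := [pred x | `[< exists2 f, diag f & x = f.@[pt] >]].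
suff /asboolP : a \in T by [].
apply: H => [|x].
  split.
  - apply/asboolP; exists 1; first exact: (bihomog_diag (@bihomog1 K n 3)).
    by rewrite meval1.
  - move=> c x y /asboolP[f fd ->] /asboolP[g gd ->]; apply/asboolP.
    exists (c%:MP%:MP * f + g); last by rewrite mevalD mevalM mevalC mul_mpolyC.
    move=> i j ij; rewrite (raddfD (bicomp i j)) /= gd // addr0.
    have cd : diag c%:MP%:MP.
      apply/(@bihomog_diag 0)/bihomogC; rewrite -[c%:MP]mulr1 mul_mpolyC.
      by rewrite rpredZ // dhomog1.
    exact: diagM.
  - move=> x y /asboolP[f fd ->] /asboolP[g gd ->]; apply/asboolP.
    by exists (f * g); [apply: diagM | rewrite mevalM].
case/andP=> /asboolP[c xE] x3; apply/asboolP.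
have xE' : x = c ord0 * g1 + c (lift ord0 ord0) * g2
    + c (lift ord0 (lift ord0 ord0)) * g3.
  by rewrite xE !big_ord_recl big_ord0 addr0 addrA.
(* A cubic form in the ideal depends only on the linear components of its coefficients; with these
   the preimage has bidegree (1, 1). *)
pose f : S := \sum_(j < 3) (pihomog mdeg 1 (c j))%:MP * 'X_j.
exists f.
  apply: (@bihomog_diag 1); apply: bihomog_sum => j _.
  apply: (@bihomogM _ _ _ 1 0 0 1); last exact: (@bihomog_var K n 3 (inr j)).
  by apply: bihomogC; apply: pihomogP.
rewrite /f ev_sum -(pihomog_dE x3) xE linear_sum /=.
apply: eq_bigr => j _; rewrite mevalM mevalC mevalXU.
exact: (pihomogM 1 (c j) (pt_homog j)).
Qed.

Lemma gens_forms h : h \in diag_gens ->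
  h.@[pt] \in subalg_gen (ideal_forms [:: g1; g2; g3] 3).
Proof.
move=> hd; have h3 := ev_diag (bihomog_diag_gens hd).
apply/asboolP=> T _; apply; apply/andP; split; last exact: h3.
have [k [j ->]] := diag_gensP hd; apply/asboolP.
exists (fun i => if i == j then 'X_k else 0).
rewrite (bigD1 j) //= eqxx big1 ?addr0 => [|i /negPf->]; last by rewrite mul0r.
by rewrite mevalM mevalC mevalXU.
Qed.

Lemma diag_ind (T : R -> Prop) :
  (forall c : K, T c%:MP) -> (forall a b, T a -> T b -> T (a + b)) ->
  (forall a h, T a -> h \in diag_gens -> T (a * h.@[pt])) ->
  forall i f, bihomog i i f -> T f.@[pt].
Proof.
move=> TC TD TM; elim=> [|i IH] f fi.
  by rewrite (dhomog0C fi.1) mevalC (dhomog0C (fi.2 _)); apply: TC.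
have [v vi ->] := diag_span fi; rewrite ev_comb.
elim/big_ind: _ => [||k _]; first by rewrite -(mpolyC0 n K); apply: TC.
  exact: TD.
by apply: TM; [apply/IH/vi | apply: mem_nth].
Qed.

Lemma ev_mem i f : bihomog i i f ->
  f.@[pt] \in subalg_gen (ideal_forms [:: g1; g2; g3] 3).
Proof.
apply: (@diag_ind (fun a => a \in subalg_gen (ideal_forms [:: g1; g2; g3] 3))).
- by move=> c; rewrite -alg_mpolyC rpredZ // rpred1.
- by move=> a b; apply: rpredD.
- by move=> a h aT hd; apply: rpredM => //; apply: gens_forms.
Qed.

Definition ambient (a : A) : R := generated_val a.

Lemma ambient_inj : injective ambient.
Proof. exact: val_inj. Qed.

Fact ambient_zmod : zmod_morphism ambient.
Proof. by []. Qed.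

Fact ambient_monoid : monoid_morphism ambient.
Proof. by []. Qed.

HB.instance Definition _ := GRing.isZmodMorphism.Build A R ambient ambient_zmod.
HB.instance Definition _ :=
  GRing.isMonoidMorphism.Build A R ambient ambient_monoid.

Lemma ambientZ c a : ambient (c *: a) = c *: ambient a.
Proof. by []. Qed.

Lemma grE i a : (a \in gr i) = (ambient a \is (3 * i).-homog).
Proof. by []. Qed.

(** Off the diagonal the value at the g_j may leave K[I_3], and 0 is then a default. The map is
    controlled through [specializeK], on bidegrees (i, i). *)
Definition specialize (f : S) : A := insubd (0 : A) f.@[pt].

Lemma specializeK i f : bihomog i i f -> ambient (specialize f) = f.@[pt].
Proof. by move=> fi; apply: insubdK; apply: ev_mem fi. Qed.

Lemma specialize_gr i f : bihomog i i f -> specialize f \in gr i.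
Proof.
by move=> fi; rewrite grE (specializeK fi); apply: ev_diag.
Qed.

Lemma ambient_diag a : exists2 f : S, diag f & ambient a = f.@[pt].
Proof. by case: a => x xA; apply: (algebra_diag xA). Qed.

Lemma decomposition (a : A) : exists (f : nat -> S) N,
  [/\ forall i, bihomog i i (f i),
      forall i, (f i).@[pt] = pihomog mdeg (3 * i) (ambient a)
    & forall M, (N <= M)%N -> a = \sum_(i < M) specialize (f i)].
Proof.
have [f fd af] := ambient_diag a; have [N fN] := diag_partition fd.
exists (fun i => bicomp i i f), N; split=> [i|i|M /fN fM].
- exact: bihomog_bicomp.
- by rewrite af ev_bicomp.
- apply: ambient_inj; rewrite af {1}fM ev_sum rmorph_sum /=;
    apply: eq_bigr => i _.
  by rewrite (specializeK (bihomog_bicomp i i f)).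
Qed.

Lemma components_eq0 m (f : nat -> A) : (forall i, f i \in gr i) ->
  \sum_(i < m) f i = 0 -> forall i, (i < m)%N -> f i = 0.
Proof.
move=> fg f0 i im; apply: ambient_inj; rewrite rmorph0.
have : pihomog mdeg (3 * i) (ambient (\sum_(i < m) f i)) = 0.
  by rewrite f0 rmorph0 linear0.
rewrite rmorph_sum linear_sum /= (bigD1 (Ordinal im)) //= big1 => [|j ji].
  by rewrite addr0 pihomog_dE // -grE.
by rewrite (pihomog_ne0 (d := (3 * j)%N)) ?eqn_pmul2l // -grE.
Qed.

Lemma gr_graded : graded_algebra gr.
Proof.
split.
- move=> i; split=> [|c u v]; rewrite !grE; first by rewrite rmorph0 rpred0.
  by move=> ui vi; apply: rpredD => //; apply: rpredZ.
- by rewrite grE rmorph1 dhomog1.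
- by move=> i j a b; rewrite !grE rmorphM mulnDr; apply: dhomogM.
- move=> a; have [f [N [fi _ /(_ N (leqnn N)) aE]]] := decomposition a.
  by exists N, (fun i => specialize (f i)); split=> // i; apply: specialize_gr.
- exact: components_eq0.
Qed.

Lemma gr0P a : a \in gr 0 <-> exists c : K, a = c%:A.
Proof.
split=> [|[c ->]]; last by rewrite grE ambientZ rmorph1 rpredZ // dhomog1.
rewrite grE => /dhomog0C aE; exists (ambient a)@_0%MM; apply: ambient_inj.
by rewrite ambientZ rmorph1 {1}aE alg_mpolyC.
Qed.

Lemma closed_sum (T : {pred A}) (I : Type) (r : seq I) (P : pred I)
    (F : I -> A) :
  GRing.subalg_closed T -> (forall i, P i -> F i \in T) ->
  \sum_(i <- r | P i) F i \in T.
Proof.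
case=> T1 Tlin TM TF; elim/big_ind: _ => //.
  by have := Tlin (-1) 1 1 T1 T1; rewrite scaleN1r addNr.
by move=> a b aT bT; have := Tlin 1 a b aT bT; rewrite scale1r.
Qed.

Lemma gr_generated a : a \in subalg_gen (gr 1).
Proof.
apply/asboolP => T Tc T1; have [T1' Tlin TM] := Tc.
have [f [N [fi _ /(_ N (leqnn N)) ->]]] := decomposition a.
apply: closed_sum => // i _.
suff [b bT bE] : exists2 b : A, b \in T & ambient b = (f i).@[pt].
  by have -> : specialize (f i) = b by apply: ambient_inj;
    rewrite bE (specializeK (fi i)).
apply: (diag_ind (T := fun x => exists2 b : A, b \in T & ambient b = x))
  (fi i) => //.
- move=> c; exists c%:A; last by rewrite ambientZ rmorph1 alg_mpolyC.
  have T0 : 0 \in T.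
    by have := Tlin (-1) 1 1 T1' T1'; rewrite scaleN1r addNr.
  by have := Tlin c 1 0 T1' T0; rewrite addr0.
- move=> x y [b bT <-] [b' bT' <-]; exists (b + b'); last exact: rmorphD.
  by have := Tlin 1 b b' bT bT'; rewrite scale1r.
- move=> x h [b bT <-] hd; have h1 := bihomog_diag_gens hd.
  exists (b * specialize h); last by rewrite rmorphM /= (specializeK h1).
  by apply: TM => //; apply/T1/specialize_gr.
Qed.

Lemma gr1_finite : exists s : seq A, {subset s <= gr 1} /\
  forall a, a \in gr 1 ->
    exists c : 'I_(size s) -> K, a = \sum_(i < size s) c i *: s`_i.
Proof.
exists (map specialize diag_gens); split=> [_ /mapP[h hd ->]|a a1].
  exact/specialize_gr/bihomog_diag_gens.
have [f [N [fi fE _]]] := decomposition a.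
have [v v0 vE] := diag_span (fi 1%N).
exists (fun i => (v 0 (cast_ord (size_map _ _) i))@_0%MM@_0%MM).
have aE : ambient a = (f 1%N).@[pt] by rewrite fE pihomog_dE // -grE.
apply: ambient_inj; rewrite aE vE ev_comb rmorph_sum /=.
rewrite (reindex (cast_ord (size_map specialize diag_gens))) /=; last first.
  by exists (cast_ord (esym (size_map specialize diag_gens))) => i _;
    rewrite ?cast_ordK ?cast_ordKV.
apply: eq_bigr => i _; set k := cast_ord _ i.
transitivity ((v 0 k)@_0%MM@_0%MM *: ambient (map specialize diag_gens)`_i);
  last by [].
rewrite (nth_map 0); last by rewrite -(size_map specialize).
have id : (i < size diag_gens)%N by rewrite -(size_map specialize).
rewrite (specializeK (bihomog_diag_gens (mem_nth 0 id))).
have [vb va] := v0 0 k.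
by rewrite {1}(dhomog0C vb) mevalC {1}(dhomog0C (va _)) mul_mpolyC.
Qed.

Lemma gr_standard : standard_graded gr.
Proof.
split; [exact: gr_graded | exact: gr0P | exact: gr1_finite |
  exact: gr_generated].
Qed.

(** * Assembling the infinite linear resolution *)

Section Resolution.
Variable J : S -> Prop.
Hypotheses (idJ : is_ideal J) (J_ev : forall f, J f -> f.@[pt] = 0)
  (ev_J : forall a b f, bihomog a b f -> f.@[pt] = 0 -> J f).
Local Notation D := (fun i => @bihomog K n 3 i i).

Lemma diagD0 i : D i 0. Proof. exact: bihomog0. Qed.
Lemma diagD1 : D 0 1. Proof. exact: bihomog1. Qed.
Lemma diagDB i a b : D i a -> D i b -> D i (a - b).
Proof. exact: bihomogB. Qed.
Lemma diagDM i j a b : D i a -> D j b -> D (i + j) (a * b).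
Proof. exact: bihomogM. Qed.

Lemma ev_mulmx m p q (X : 'M[S]_(m, p)) (Y : 'M[S]_(p, q)) i j :
  ((X *m Y) i j).@[pt] = \sum_k (X i k).@[pt] * (Y k j).@[pt].
Proof.
by rewrite mxE ev_sum; apply: eq_bigr => k _; rewrite mevalM.
Qed.

Lemma ambient_mulmx m p q (X : 'M[A]_(m, p)) (Y : 'M[A]_(p, q)) i j :
  ambient ((X *m Y) i j) = \sum_k ambient (X i k) * ambient (Y k j).
Proof.
by rewrite mxE rmorph_sum /=; apply: eq_bigr.
Qed.

Lemma specialize_mulmx i j m p q (X : 'M[S]_(m, p)) (Y : 'M[S]_(p, q)) :
  entries (D i) X -> entries (D j) Y ->
  map_mx specialize (X *m Y) = map_mx specialize X *m map_mx specialize Y.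
Proof.
move=> hX hY; apply/matrixP=> a b; apply: ambient_inj.
have hXY := entriesDM diagD0 diagDB diagDM hX hY a b.
rewrite ambient_mulmx mxE (specializeK hXY) ev_mulmx; apply: eq_bigr => k _.
by rewrite !mxE (specializeK (hX a k)) (specializeK (hY k b)).
Qed.

Lemma specialize_mod i m p (X Y : 'M[S]_(m, p)) :
  entries (D i) X -> entries (D i) Y -> entries J (X - Y) ->
  map_mx specialize X = map_mx specialize Y.
Proof.
move=> hX hY hJ; apply/matrixP=> a b; apply: ambient_inj; rewrite !mxE.
rewrite (specializeK (hX a b)) (specializeK (hY a b)).
have := J_ev (hJ a b); rewrite [X in meval _ X]mxE [X in meval _ (_ + X)]mxE.
by rewrite mevalB => /eqP; rewrite subr_eq0 => /eqP.
Qed.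

Lemma lift_row r (v : 'rV[A]_r) : exists (V : nat -> 'rV[S]_r) N,
  [/\ forall d, entries (D d) (V d),
      forall d k, (V d 0 k).@[pt] = pihomog mdeg (3 * d) (ambient (v 0 k))
    & forall M, (N <= M)%N -> v = \sum_(d < M) map_mx specialize (V d)].
Proof.
have dec (k : 'I_r) : exists p : (nat -> S) * nat,
    [/\ forall i, bihomog i i (p.1 i),
        forall i, (p.1 i).@[pt] = pihomog mdeg (3 * i) (ambient (v 0 k))
      & forall M, (p.2 <= M)%N -> v 0 k = \sum_(i < M) specialize (p.1 i)].
  by have [f [N h]] := decomposition (v 0 k); exists (f, N).
have [p pP] := fin_all_exists dec.
exists (fun d => \row_k (p k).1 d), (\max_k (p k).2).
split=> [d i k|d k|M NM].
- by rewrite mxE; case: (pP k).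
- by rewrite mxE; case: (pP k).
- apply/rowP=> k; rewrite summxE.
  under eq_bigr do rewrite !mxE.
  case: (pP k) => _ _; apply; apply: leq_trans NM.
  exact: (leq_bigmax k).
Qed.

(** The state of a recursion that builds the resolution. The rank belongs to it because it varies
    from step to step; linearity for all p makes the choice of syzygies in [next] repeatable
    forever. *)
Record stage := Stage {
  gens_nb : nat;
  rels : 'rV[S]_gens_nb -> Prop;
  rels_linear : forall p, lin D J p rels
}.

Arguments rels : clear implicits.

Lemma rels_stable (st : stage) :
  (forall v, entries (D 0) v -> rels st v -> v = 0) /\
  exists s (W : 'M[S]_(s, gens_nb st)),
    [/\ entries (D 1) W, forall k, rels st (row k W),
        forall i v, entries (D i.+1) v -> rels st v ->
          exists2 c, entries (D i) c & entries J (v - c *m W)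
      & forall p, lin D J p (fun c : 'rV_s => entries J (c *m W))].
Proof.
exact: (lin_stable diagD0 diagD1 diagDB diagDM idJ (@rels_linear st)).
Qed.

Definition syzygies_nb st := sval (cid (rels_stable st).2).

Definition syzygies st : 'M[S]_(syzygies_nb st, gens_nb st) :=
  sval (cid (svalP (cid (rels_stable st).2))).

Lemma syzygiesP st :
  [/\ entries (D 1) (syzygies st), forall k, rels st (row k (syzygies st)),
      forall i v, entries (D i.+1) v -> rels st v ->
        exists2 c, entries (D i) c & entries J (v - c *m syzygies st)
    & forall p, lin D J p
        (fun c : 'rV_(syzygies_nb st) => entries J (c *m syzygies st))].
Proof. exact: svalP (cid (svalP (cid (rels_stable st).2))). Qed.

Definition next st : stage :=
  Stage (fun p => let: And4 _ _ _ h := syzygiesP st in h p).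

Definition differential st : 'M[A]_(syzygies_nb st, gens_nb st) :=
  map_mx specialize (syzygies st).

Lemma differential_gr st i j : differential st i j \in gr 1.
Proof.
by rewrite mxE; case: (syzygiesP st) => W1 _ _ _;
  apply: specialize_gr.
Qed.

(** The resolution in S only concerns homogeneous rows, so [v] is lifted to S degree by degree, each
    component is expressed by the syzygies modulo J, and the results are added up. *)
Lemma differential_exact st (v : 'rV[A]_(gens_nb st)) :
  (forall d V, entries (D d) V ->
     (forall k, (V 0 k).@[pt] = pihomog mdeg (3 * d) (ambient (v 0 k))) ->
     rels st V) ->
  exists w, v = w *m differential st.
Proof.
move=> vrels; have [V [N [VD Vv vE]]] := lift_row v.
have Vrels d : rels st (V d) by apply: vrels (Vv d).
have [U0 _] := rels_stable st; have [W1 _ genW _] := syzygiesP st.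
have coord d : exists c, entries (D d) c /\
    entries J (V d.+1 - c *m syzygies st).
  by have [c] := genW d _ (VD _) (Vrels _); exists c.
have [c cP] := choice coord.
exists (\sum_(d < N) map_mx specialize (c d)).
(* The component of degree 0 vanishes by minimality; the remaining ones, of degree d + 1, have
   coordinates of degree d. *)
rewrite (vE N.+1) // big_ord_recl (U0 _ (VD 0%N) (Vrels _)).
have -> : map_mx specialize (0 : 'rV[S]_(gens_nb st)) = 0.
  apply/rowP=> k; apply: ambient_inj; rewrite !mxE (specializeK (diagD0 0)).
  by rewrite meval0.
rewrite add0r mulmx_suml; apply: eq_bigr => d _ /=.
have [cD cJ] := cP d; rewrite /differential -(specialize_mulmx cD W1).
apply: specialize_mod (VD _) _ cJ.
by have := entriesDM diagD0 diagDB diagDM cD W1; rewrite addn1.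
Qed.

Lemma differential_comp st : differential (next st) *m differential st = 0.
Proof.
have [W1 _ _ _] := syzygiesP st; have [W1' W'rels _ _] := syzygiesP (next st).
rewrite /differential -(specialize_mulmx W1' W1).
have h0 : entries (D 2) (0 : 'M[S]_(syzygies_nb (next st), gens_nb st)).
  by move=> i j; rewrite mxE; apply: diagD0.
rewrite (specialize_mod _ h0).
- by apply/matrixP=> i j; apply: ambient_inj;
    rewrite !mxE (specializeK (diagD0 0)) meval0.
- exact: (entriesDM diagD0 diagDB diagDM W1' W1).
- move=> i j; rewrite subr0; have := W'rels i 0 j.
  by rewrite -row_mul mxE.
Qed.

Lemma differential_kernel st (v : 'rV[A]_(syzygies_nb st)) :
  v *m differential st = 0 <-> exists w, v = w *m differential (next st).
Proof.
split=> [v0|[w ->]]; last by rewrite -mulmxA differential_comp mulmx0.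
apply: (differential_exact (st := next st)) => d V VD Vv i j.
have [W1 _ _ _] := syzygiesP st.
have VW := entriesDM diagD0 diagDB diagDM VD W1.
rewrite [i]ord1; apply: ev_J (VW 0 j) _.
(* The entries of the differential have polynomial degree 3, so the component of [v] of degree 3d
   contributes to degree 3(d + 1) of the product. *)
have := congr1 (fun M : 'rV[A]__ =>
  pihomog mdeg (3 * (d + 1)) (ambient (M 0 j))) v0.
rewrite /= ambient_mulmx mxE rmorph0 linear0 linear_sum /= => E.
rewrite ev_mulmx -[RHS]E; apply: eq_bigr => k _;
  rewrite mxE (specializeK (W1 k j)) Vv mulnDr.
by rewrite (pihomogM _ _ (ev_diag (W1 k j))).
Qed.

Lemma pihomog_coef0 (p : R) : (pihomog mdeg 0 p)@_0%MM = p@_0%MM.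
Proof.
rewrite [in RHS](pihomog_partitionE (mf := mdeg) (leqnSn (msize p))).
rewrite [RHS]raddf_sum big_ord_recl [X in _ = _ + X]big1 ?addr0 // => i _.
by apply: (dhomog_nemf_coeff (pihomogP mdeg _ _)); rewrite /= mdeg0.
Qed.

Lemma mcoeff0M (p q : R) : (p * q)@_0%MM = p@_0%MM * q@_0%MM.
Proof. exact: (rmorphM (mcoeff 0%MM)). Qed.

Lemma irrelevantP (a : A) : irrelevant_ideal gr a <-> (ambient a)@_0%MM = 0.
Proof.
split=> [[m [f [fg ->]]]|a0].
  rewrite rmorph_sum raddf_sum /= big1 // => i _.
  by apply: (dhomog_nemf_coeff (fg i)); rewrite /= mdeg0 mulnS.
have [f [N [fi fE aE]]] := decomposition a.
exists N, (fun i => specialize (f i.+1)); split=> [i|];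
  first exact: specialize_gr.
rewrite {1}(aE N.+1) // big_ord_recl.
suff -> : specialize (f 0%N) = 0 by rewrite add0r.
apply: ambient_inj; rewrite (specializeK (fi 0%N)) rmorph0.
have f0 := ev_diag (fi 0%N).
by rewrite (dhomog0C f0) fE pihomog_coef0 a0 mpolyC0.
Qed.

Lemma koszul_of_linear Z : (forall v, v \in Z) ->
  (forall p, linear_upto J p (igen (map (@var K n 3) Z)) [:: 1]) -> koszul gr.
Proof.
move=> Zall linN; split; first exact: gr_standard.
pose st0 := @Stage 1 (@relations K n 3 (igen (map (@var K n 3) Z)) [:: 1]) linN.
pose st i := iter i next st0.
have homog_diffP i (r : 'I_(gens_nb (st i.+1))) (c : 'I_(gens_nb (st i))) :
    homog_diff gr i.+1 i (differential (st i) r c).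
  by rewrite /homog_diff leqnSn subSnn; apply: differential_gr.
have aug_homog (c : 'I_1) : 0%N != 0%N -> (const_mx 1 : 'cV[K]_1) c 0 = 0 by [].
have aug_surj : (const_mx 1 : 'cV[K]_1) != 0.
  by apply/eqP=> /matrixP/(_ 0 0)/eqP; rewrite !mxE oner_eq0.
have exact0 (v : 'rV[A]_1) :
    irrelevant_ideal gr (\sum_c v 0 c * ((const_mx 1 : 'cV[K]_1) c 0)%:A)
    <-> exists w, v = w *m differential st0.
  rewrite big_ord1 mxE scale1r mulr1 irrelevantP; split=> [v0|[w ->]].
    apply: (differential_exact (st := st0)) => d V VD Vv.
    have Vd := VD 0 0; rewrite /= /relations comb1.
    (* In degree 0 the lift is a constant, equal to the vanishing constant term of [v]; a form of
       bidegree (d + 1, d + 1) lies in the ideal of all the variables. *)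
    case: d VD Vv Vd => [|d] _ Vv Vd.
      rewrite (dhomog0C Vd.1) (dhomog0C (Vd.2 _)).
      have := Vv 0; rewrite {1}(dhomog0C Vd.1) mevalC => ->.
      have -> : (pihomog mdeg (3 * 0) (ambient (v 0 0)))@_0%MM = 0.
        by rewrite pihomog_coef0.
      by rewrite !mpolyC0; apply: ideal0.
    apply: (igen_side (s := true) (a := d) (b := d.+1)) => [x _|];
      first exact: Zall.
    by rewrite addn1 addn0.
  rewrite ambient_mulmx raddf_sum /= big1 // => k _.
  have d1 : ambient (differential st0 k 0) \is 3.-homog :=
    @differential_gr st0 k 0.
  by rewrite mcoeff0M (dhomog_nemf_coeff d1) ?mulr0 //= mdeg0.
exists (@GradedFreeResolution K A gr (fun i => gens_nb (st i)) (fun i _ => i)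
  (const_mx 1) (fun i => differential (st i)) aug_homog homog_diffP aug_surj
  exact0 (fun i => @differential_kernel (st i))).
by [].
Qed.

End Resolution.

End Specialization.

Lemma ideal_genP (B : comNzRingType) (s : seq B) f : ideal_gen s f <-> igen s f.
Proof.
split=> [[c ->]|].
  elim/big_ind: _ => [||i _]; first exact: ideal0.
    by move=> a b; apply: idealD.
  by apply: idealM => //; apply/igen_mem/mem_nth.
elim: s f => [|h t IH] f; first by move=> ->; exists (fun=> 0);
  rewrite big_ord0.
case=> c /IH[d fE]; exists (fun i => oapp d c (unlift ord0 i)).
rewrite big_ord_recl unlift_none /= -[LHS](subrK (c * h)) fE addrC;
  congr (_ + _).
by apply: eq_bigr => i _; rewrite liftK.
Qed.

Theorem corollary3p3 (K : fieldType) (n : nat) (g1 g2 g3 : {mpoly K[n]})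
    (hg1 : g1 \is 2.-homog) (hg2 : g2 \is 2.-homog) (hg3 : g3 \is 2.-homog)
    (hreg : regular_sequence [:: g1; g2; g3]) :
  koszul (@ideal_forms_grading K n [:: g1; g2; g3] 3).
Proof.
have [reg _] := hreg.
have g1_neq0 : g1 <> 0.
  (* Regularity at index 0 applied to f = 1: if g_1 were 0, then 1 would lie in the zero ideal. *)
  move=> g0; have/ideal_genP/eqP : ideal_gen [::] (1 : {mpoly K[n]}).
    by apply: (reg 0%N) => //; apply/ideal_genP; rewrite /= g0 mul0r.
  by rewrite oner_eq0.
have g2_reg f : igen [:: g1] (f * g2) -> igen [:: g1] f.
  by rewrite mulrC => /ideal_genP H; apply/ideal_genP/(reg 1%N f isT).
have g3_reg f : igen [:: g2; g1] (f * g3) -> igen [:: g2; g1] f.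
  have perm h : igen [:: g2; g1] h <-> ideal_gen [:: g1; g2] h.
    rewrite ideal_genP; split; apply: igen_subset => x; rewrite !inE orbC //.
  by rewrite mulrC => /perm H; apply/perm/(reg 2 f isT).
have [J [idJ J_ev ev_J linN]] :=
  specialization_kernel hg1 hg2 hg3 g1_neq0 g2_reg g3_reg.
apply: (koszul_of_linear hg1 hg2 hg3 idJ J_ev ev_J _ linN) => v.
by rewrite mem_enum.
Qed.
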